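(* For every $\beta>0$ there exists $\varepsilon_0>0$ (depending only on $\beta$) such that the following holds. Suppose $v_2,v_3$ satisfy (i$_2$)–(iii$_2$) and (i$_3$)–(iv$_3$) for some $0<\varepsilon<\varepsilon_0$. Then there exists $N_\beta\in\mathbb{N}$ such that for every $N\ge N_\beta$ and every configuration $C_N$ of $N$ particles, $$\mathcal{F}_\beta(C_N)\ \ge\ -2N+\tfrac12\, m_\beta(N).$$ Moreover, if equality holds, then $C_N\subset \mathbb{Z}^2\cap\{x_2>0\}$ and $\#\big(C_N\cap\{x_2=1\}\big)\ge N/h_*(\beta,N)$.
   Context: Substrate: $\mathcal{L}^-=\mathbb{Z}^2\cap\{x_2\le 0\}$. A configuration of $N$ particles is a set $C_N=\{x_1,\dots,x_N\}$ of $N$ distinct points of $\{x\in\mathbb{R}^2:x_2>0\}$. For points $x,y,z$, $\theta_{x,y,z}\in[0,2\pi)$ is the angle formed by the vectors $x-y$ and $z-y$, measured clockwise. Given $\beta>0$ and $\varepsilon>0$, the potentials $v_2:[0,\infty)\to\mathbb{R}\cup\{+\infty\}$, $v_3:[0,2\pi]\to\mathbb{R}$ are required to satisfy: (i$_2$) $\min_{r\ge0}v_2(r)=v_2(1)=-1$ and $v_2(r)>-1$ for $r\ne1$; (ii$_2$) there is $r_0\in(1,\sqrt2)$ with $v_2(r)=0$ for all $r\ge r_0$; (iii$_2$) $v_2(r)>\varepsilon^{-1}$ for all $r\in[0,1-\varepsilon]$; (i$_3$) $v_3(\theta)=v_3(2\pi-\theta)$ for all $\theta$; (ii$_3$) $v_3(k\pi/2)=0$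 for $k=1,2,3$ and $v_3(\theta)>0$ for $\theta\notin\{\pi/2,\pi,3\pi/2\}$; (iii$_3$) $v_3(\theta)\ge 4(\pi/10-\varepsilon)^{-1}|\theta-\pi|$ for all $\theta\in[\pi-\varepsilon,\pi+\varepsilon]$, with equality only at $\theta=\pi$; (iv$_3$) if $\theta\notin[\pi/2-\varepsilon,\pi/2+\varepsilon]\cup[\pi-\varepsilon,\pi+\varepsilon]\cup[3\pi/2-\varepsilon,3\pi/2+\varepsilon]$ then $v_3(\theta)>\max\{1,2\beta\}\frac{4}{(1-\varepsilon)^2}(\sqrt2+\tfrac12)^2$. Energy: $$\mathcal{F}_\beta(C_N)=\frac12\sum_{x_i\ne x_j\in C_N}v_2(|x_i-x_j|)+\beta\sum_{x_i\in C_N,\,z\in\mathcal{L}^-}v_2(|x_i-z|)+\frac12\sum_{(x,y,z)}v_3(\theta_{x,y,z}),$$ the last sum over triples of pairwise distinct points of $C_N\cup\mathcal{L}^-$ with $|x-y|<r_0$, $|y-z|<r_0$. Define $$m_\beta(N)=\min_{h\in\{1,\dots,N\}}\Big(2h+2(1-\beta)\Big\lceil\frac Nh\Big\rceil\Big),\qquad h_*(\beta,N)=\max\Big\{h\in\{1,\dots,N\}:2h+2(1-\beta)\Big\lceil\frac Nh\Big\rceil=m_\beta(N)\Big\}.$$ *)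

(* Defs.v *)
From HB Require Import structures.
From mathcomp Require Import all_boot all_order all_algebra.
From mathcomp Require Import all_classical all_reals all_analysis.
Set Implicit Arguments. Unset Strict Implicit. Unset Printing Implicit Defensive.
Import Order.TTheory GRing.Theory Num.Theory.
Local Open Scope classical_set_scope.
Local Open Scope ring_scope.

Section Defs.
Variable R : realType.

Definition pt := (R * R)%type.

Definition dist (p q : pt) : R :=
  Num.sqrt ((p.1 - q.1) ^+ 2 + (p.2 - q.2) ^+ 2).

Definition Lminus : set pt :=
  [set p | exists a b : int, p = (a%:~R, b%:~R) /\ (b <= 0)%R].

(* theta_{x,y,z} in [0, 2 pi): angle from the vector x - y to the vector
   z - y, measured clockwise.  With u = x - y, w = z - y, the clockwise
   angle t satisfies cos t = (u.w)/(|u||w|) and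
   sin t = (u_2 w_1 - u_1 w_2)/(|u||w|). *)
Definition theta (x y z : pt) : R :=
  let u1 := x.1 - y.1 in let u2 := x.2 - y.2 in
  let w1 := z.1 - y.1 in let w2 := z.2 - y.2 in
  let c := (u1 * w1 + u2 * w2) / (dist x y * dist z y) in
  if u1 * w2 - u2 * w1 <= 0 then acos c else 2 * pi - acos c.

Definition cond_i2 (v2 : R -> \bar R) : Prop :=
  v2 1 = (- 1)%:E /\
  (forall r : R, 0 <= r -> ((- 1)%:E <= v2 r)%E) /\
  (forall r : R, 0 <= r -> r != 1 -> ((- 1)%:E < v2 r)%E).

Definition cond_ii2 (r0 : R) (v2 : R -> \bar R) : Prop :=
  1 < r0 /\ r0 < Num.sqrt 2 /\ (forall r : R, r0 <= r -> v2 r = 0%E).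

Definition cond_iii2 (eps : R) (v2 : R -> \bar R) : Prop :=
  forall r : R, 0 <= r -> r <= 1 - eps -> ((eps^-1)%:E < v2 r)%E.

Definition cond_i3 (v3 : R -> R) : Prop :=
  forall t : R, 0 <= t -> t <= 2 * pi -> v3 t = v3 (2 * pi - t).

Definition cond_ii3 (v3 : R -> R) : Prop :=
  v3 (pi / 2) = 0 /\ v3 pi = 0 /\ v3 (3 * pi / 2) = 0 /\
  (forall t : R, 0 <= t -> t <= 2 * pi ->
     t != pi / 2 -> t != pi -> t != 3 * pi / 2 -> 0 < v3 t).

Definition cond_iii3 (eps : R) (v3 : R -> R) : Prop :=
  forall t : R, pi - eps <= t -> t <= pi + eps ->
    4 * (pi / 10 - eps)^-1 * `|t - pi| <= v3 t /\
    (v3 t = 4 * (pi / 10 - eps)^-1 * `|t - pi| -> t = pi).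

Definition in_band (eps c t : R) : Prop := c - eps <= t /\ t <= c + eps.

Definition cond_iv3 (eps beta : R) (v3 : R -> R) : Prop :=
  forall t : R, 0 <= t -> t <= 2 * pi ->
    ~ in_band eps (pi / 2) t -> ~ in_band eps pi t -> ~ in_band eps (3 * pi / 2) t ->
    Num.max 1 (2 * beta) * (4 / (1 - eps) ^+ 2) * (Num.sqrt 2 + 2^-1) ^+ 2 < v3 t.

(* A configuration of N particles is an injective map x : 'I_N -> R^2
   (so C_N = range x has exactly N distinct points) with x_2 > 0. *)

Definition allpts (N : nat) (x : 'I_N -> pt) : set pt := range x `|` Lminus.

Definition triples (r0 : R) (N : nat) (x : 'I_N -> pt) : set (pt * pt * pt) :=
  [set t | allpts x t.1.1 /\ allpts x t.1.2 /\ allpts x t.2 /\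
           t.1.1 <> t.1.2 /\ t.1.2 <> t.2 /\ t.1.1 <> t.2 /\
           dist t.1.1 t.1.2 < r0 /\ dist t.1.2 t.2 < r0].

(* The energy F_beta(C_N).  The (formally infinite) sums over the substrate
   are finitely supported sums (fsbigop: \sum_(z \in A) F z). *)
Definition energy (v2 : R -> \bar R) (v3 : R -> R) (beta r0 : R)
    (N : nat) (x : 'I_N -> pt) : \bar R :=
  ((2^-1)%:E * (\sum_(i < N) \sum_(j < N | j != i) v2 (dist (x i) (x j)))
   + beta%:E * (\sum_(i < N) \sum_(z \in Lminus) v2 (dist (x i) z))
   + (2^-1)%:E * (\sum_(t \in triples r0 x) (v3 (theta t.1.1 t.1.2 t.2))%:E))%E.

Definition mfun (beta : R) (N h : nat) : R :=
  2 * h%:R + 2 * (1 - beta) * (Num.ceil (N%:R / h%:R : R))%:~R.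

Definition mbeta (beta : R) (N : nat) : R :=
  \big[Num.min/mfun beta N 1]_(1 <= h < N.+1) mfun beta N h.

Definition hstar (beta : R) (N : nat) : nat :=
  \max_(1 <= h < N.+1 | mfun beta N h == mbeta beta N) h.

End Defs.

(* Main.v *)
(** Call two points bonded when they are closer than [r0].  Suppose first that
    some bond angle involving a particle [p] is far from all multiples of
    [pi / 2].  If [p] has [M] bonds, at least [M - 4] of its angles are bad, so
    deleting [p] does not raise the energy; since the claimed bound strictly
    decreases with [N], such a configuration cannot reach it.

    Otherwise divide the directions modulo [pi] into eight sectors with a common
    shift.  On average over the shift, the number of nearly straight pairs of
    bonds split between two sectors is bounded by the total bending, which
    (iii_3) makes cheaper than the elastic energy.  The bonds of one sector form
    disjoint monotone chains, and each particle lies on one chain in each of two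
    nearly orthogonal directions (isolated points counting as chains); hence,
    with [n] chains, there are [2N - n] bonds up to the split pairs.

    The graph with the chains as vertices and the particles as edges is simple
    and triangle-free, because three pairwise nearly orthogonal sectors do not
    exist and two chains of different sectors meet at most once.  The [s] chains
    bonded to the substrate are nearly vertical, so they are independent.  As in
    Mantel's theorem, if [a] is the independence number then
    [N <= (n - a) * a], and [s <= a]; minimising [n - beta * s] gives
    [m_beta / 2].  Equality forces [s = a], so that every chain is, or crosses,
    a chain bonded to the substrate, and all bonds are rigid: the lattice
    propagates from the substrate to every particle. *)
Require Import Defs.
From HB Require Import structures.
From mathcomp Require Import all_boot all_order all_algebra.
From mathcomp Require Import all_classical all_reals all_analysis.
From mathcomp Require Import zify lra ring.
Set Implicit Arguments. Unset Strict Implicit. Unset Printing Implicit Defensive.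
Import Order.TTheory GRing.Theory Num.Theory.

(** * Triangle-free graphs *)

Section TriangleFree.
Import fintype boot.finset.
Variables (T V : finType) (A : {set T}) (VV S : {set V}) (e1 e2 : T -> V).

(** Edges are indexed by [A], with ends [e1] and [e2]; in the application [A] holds the particles
    and [V] the chains. *)
Definition adj (v u : V) : bool :=
  [exists p in A, ((e1 p == v) && (e2 p == u)) || ((e1 p == u) && (e2 p == v))].

Definition indep (I : {set V}) : bool :=
  (I \subset VV) && [forall v in I, forall u in I, ~~ adj v u].

Hypothesis e1V : forall p, p \in A -> e1 p \in VV.
Hypothesis e2V : forall p, p \in A -> e2 p \in VV.
Hypothesis simple1 : forall p q, p \in A -> q \in A -> e1 p = e1 q -> e2 p = e2 q -> p = q.
Hypothesis simple2 : forall p q, p \in A -> q \in A -> e1 p = e2 q -> e2 p = e1 q -> p = q.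
Hypothesis tri_free : forall v u w, adj v u -> adj v w -> ~~ adj u w.
Hypothesis S_indep : indep S.

Lemma adjC v u : adj v u = adj u v.
Proof. by apply/eq_existsb => p; rewrite orbC. Qed.

Lemma adj_edge p : p \in A -> adj (e1 p) (e2 p).
Proof. by move=> pA; apply/exists_inP; exists p; rewrite ?eqxx. Qed.

Lemma adjV v u : adj v u -> u \in VV.
Proof.
case/exists_inP=> p pA /orP[] /andP[/eqP E1 /eqP E2].
- by rewrite -E2 e2V.
- by rewrite -E1 e1V.
Qed.

(* Every vertex of a triangle-free graph has at most as many neighbours as a
   maximum independent set [I] has elements, and the complement of [I] meets
   every edge. *)
Lemma triangle_free_bound : exists a : nat,
  [/\ #|S| <= a, a <= #|VV|, #|A| <= (#|VV| - a) * a &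
      #|S| = a -> forall v, v \in VV -> v \in S \/ exists2 u, u \in S & adj v u].
Proof.
case: (@arg_maxnP _ S indep (fun I => #|I|) S_indep) => I I_indep I_max.
have /andP[IV /forall_inP I_ind] := I_indep.
have nbr_le v : #|[set u | adj v u]| <= #|I|.
  apply: I_max; apply/andP; split.
    by apply/subsetP => u; rewrite inE => /adjV.
  apply/forall_inP => u; rewrite inE => vu; apply/forall_inP => w; rewrite inE.
  exact: tri_free.
exists #|I|; split; [exact: I_max | exact: subset_leq_card | | ].
(* [g] lists the end outside [I] first; independence of [I] guarantees that there is one. *)
- pose g p := if e1 p \in I then (e2 p, e1 p) else (e1 p, e2 p).
  pose P := [set vu : V * V | (vu.1 \in VV :\: I) && adj vu.1 vu.2].
  have gP : g @: A \subset P.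
    apply/subsetP => _ /imsetP[p pA ->]; rewrite /g inE.
    case: ifP => e1I /=; rewrite inE ?e1I ?e1V ?e2V ?adj_edge ?andbT //.
    apply/andP; split; last by rewrite adjC adj_edge.
    apply/negP => e2I; have /forall_inP/(_ _ e2I) := I_ind _ e1I.
    by rewrite adj_edge.
  have <- : #|g @: A| = #|A|.
    apply: card_in_imset => p q pA qA; rewrite /g.
    case: ifP => _; case: ifP => _ [] E1 E2;
      by [exact: simple1 | exact: simple2].
  apply: leq_trans (subset_leq_card gP) _.
  have -> : #|P| = \sum_(v in VV :\: I) #|[set u | adj v u]|.
    rewrite -sum1_card (eq_bigl (fun vu => (vu.1 \in VV :\: I) && adj vu.1 vu.2));
      last by move=> vu; rewrite inE.
    rewrite -(pair_big_dep (mem (VV :\: I)) (fun v u => adj v u) (fun _ _ => 1)) /=.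
    by apply: eq_bigr => v _; rewrite sum1_card cardsE.
  have <- : \sum_(v in VV :\: I) #|I| = (#|VV| - #|I|) * #|I|.
    by rewrite sum_nat_const cardsD (setIidPr IV).
  by apply: leq_sum => v _.
- move=> SI v vV; case: (boolP (v \in S)) => [|vS]; first by left.
  right; apply/exists_inP; apply/contraT => /exists_inPn nadj.
  have /andP[SV /forall_inP S_ind] := S_indep.
  (* If [S] is itself of maximum size, a vertex outside it without neighbour in it could be
     added. *)
  suff /I_max/= : indep (v |: S) by rewrite cardsU1 vS SI; lia.
  apply/andP; split; first by rewrite subUset sub1set vV.
  have nvv : ~~ adj v v by apply/negP => vv; have := tri_free vv vv; rewrite vv.
  apply/forall_inP => u /setU1P[->|uS]; apply/forall_inP => w /setU1P[->|wS] //.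
  - exact: nadj.
  - by rewrite adjC nadj.
  - by have /forall_inP/(_ _ wS) := S_ind _ uS.
Qed.
End TriangleFree.

(** * Chains of bonds *)

Section Chains.
Import fintype boot.finset.
Variables (T : finType) (A sub : {set T}) (near : rel T) (o : T -> T -> nat).

Definition absdiff (a b : nat) := (a - b) + (b - a).
(** Directions are indexed modulo 16 in units of [pi / 8]: the three ranges are what remains of
    angles near [pi / 2], [pi] and [3 * pi / 2] once both directions are rounded down. *)
Definition right_diff a b :=
  [|| 3 <= absdiff a b <= 5, 7 <= absdiff a b <= 9 | 11 <= absdiff a b <= 13].
(** A nearly straight pair of directions that misses the exactly opposite sectors, whose difference
    is 8. *)
Definition cut_diff a b := (absdiff a b == 7) || (absdiff a b == 9).
(** Meant for sectors modulo 8, that is for unoriented lines, where a right angle is 4 units. *)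
Definition perp_sec a b := 3 <= absdiff a b <= 5.

Definition nbr (p : T) : {set T} := [set y in A :|: sub | near p y].
(** Here and in [bonds] the tuples are ordered, so every cut and every bond counts twice. *)
Definition cuts : {set T * T * T} :=
  [set t | [&& t.1.2 \in A, t.1.1 \in nbr t.1.2, t.2 \in nbr t.1.2
             & cut_diff (o t.1.2 t.1.1) (o t.1.2 t.2)]].
Definition bonds : {set T * T} := [set t | [&& t.1 \in A, t.2 \in A & near t.1 t.2]].
Definition contacts : {set T * T} := [set t | [&& t.1 \in A, t.2 \in sub & near t.1 t.2]].

Hypothesis A_sub : forall p, p \in A -> p \notin sub.
Hypothesis near_sym : symmetric near.
Hypothesis near_irr : irreflexive near.
Hypothesis o_lt : forall x y, o x y < 16.
Hypothesis o_rev : forall x y, x != y -> o y x = (o x y + 8) %% 16.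
Hypothesis o_cone : forall x y z, x != y -> y != z -> o x y = o y z ->
  x != z /\ o x z = o x y.
Hypothesis o_good : forall p y w, p \in A -> y \in nbr p -> w \in nbr p -> y != w ->
  right_diff (o p y) (o p w).
Variable c0 : nat.
Hypothesis c0_range : 3 <= c0 <= 4.
Hypothesis o_sub : forall p z, p \in A -> z \in sub -> near p z -> c0.-1 <= o z p <= c0.+1.

Lemma near_neq x y : near x y -> x != y.
Proof. by apply: contraTneq => ->; rewrite near_irr. Qed.

Lemma nbr_A p q : q \in A -> near p q -> q \in nbr p.
Proof. by move=> qA pq; rewrite !inE qA pq. Qed.

Lemma nbr_sub p q : q \in sub -> near p q -> q \in nbr p.
Proof. by move=> qS pq; rewrite !inE qS pq orbT. Qed.

Lemma o_inj p y w : p \in A -> y \in nbr p -> w \in nbr p -> o p y = o p w -> y = w.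
Proof.
move=> pA yp wp E; apply/eqP/contraT => /(o_good pA yp wp).
by rewrite /right_diff /absdiff E; lia.
Qed.

(** * Moving along the bonds of one sector *)

Definition up (k : nat) (p : T) : T :=
  if [pick q | [&& q \in A, near p q & o p q == k]] is Some q then q else p.

Lemma upE k p q : p \in A -> q \in A -> near p q -> o p q = k -> up k p = q.
Proof.
move=> pA qA pq E; rewrite /up; case: pickP => [r /and3P[rA pr /eqP Er]|/(_ q)].
  by apply: (@o_inj p) => //; rewrite ?nbr_A ?Er.
by rewrite qA pq E eqxx.
Qed.

Variant up_spec (k : nat) (p : T) : T -> Type :=
 | UpFix : (forall q, q \in A -> near p q -> o p q <> k) -> up_spec k p p
 | UpMove q : q \in A -> near p q -> p != q -> o p q = k -> up_spec k p q.

Lemma upP k p : up_spec k p (up k p).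
Proof.
rewrite /up; case: pickP => [r /and3P[rA pr /eqP Er]|no].
  by apply: UpMove => //; exact: near_neq.
by apply: UpFix => q qA pq E; have := no q; rewrite qA pq E eqxx.
Qed.

Lemma up_inA k p : p \in A -> up k p \in A.
Proof. by case: upP. Qed.

Lemma iter_up_inA k n p : p \in A -> iter n (up k) p \in A.
Proof. by move=> pA; elim: n => //= n; exact: up_inA. Qed.

Lemma up_inj k x y : k < 8 -> x \in A -> y \in A -> up k x = up k y ->
  up k x != x -> up k y != y -> x = y.
Proof.
move=> k8 xA yA; case: (upP k x) => [_|q qA xq nxq Ex]; first by rewrite eqxx.
case: (upP k y) => [_ _ _|r rA yr nyr Ey Er _ _]; first by rewrite eqxx.
subst r; apply: (@o_inj q) => //; rewrite ?nbr_A // 1?near_sym //.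
by rewrite (o_rev nxq) (o_rev nyr) Ex Ey.
Qed.

(** A sector is closed under addition, so whatever is reached by steps in sector [k] is seen in
    sector [k]; in particular a chain never closes up. *)
Lemma iter_up_cone k n p : p \in A ->
  iter n (up k) p = p \/ (p != iter n (up k) p /\ o p (iter n (up k) p) = k).
Proof.
move=> pA; elim: n => [|n IH] /=; first by left.
case: (upP k (iter n (up k) p)) => // q qA _ nq Eq.
case: IH => [E|[np Ep]]; first by right; rewrite E in nq Eq.
by right; have [] := o_cone np nq (etrans Ep (esym Eq)); rewrite Ep.
Qed.

(** Each proper step strictly shrinks the set of points seen in sector [k], so [#|T|] steps reach
    the end. *)
Lemma iter_up_stable k p : up k (iter #|T| (up k) p) = iter #|T| (up k) p.
Proof.
pose mu x := #|[set y | (x != y) && (o x y == k)]|.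
suff H n x : mu x <= n -> up k (iter n (up k) x) = iter n (up k) x.
  by apply: H; exact: max_card.
elim: n x => [|n IH] x mux.
  rewrite /=; case: upP => // q qA _ nq Eq.
  suff : 0 < mu x by lia.
  by apply/card_gt0P; exists q; rewrite inE nq Eq /=.
rewrite iterSr; case: (upP k x) => [fx|q qA xq nq Eq].
  have ux : up k x = x by case: (upP k x) => // q qA xq _ /(fx _ qA xq).
  by have -> : iter n (up k) x = x by elim: n {IH mux} => //= n ->.
apply: IH; rewrite -ltnS; apply: leq_trans mux; apply: proper_card.
apply/properP; split; last by exists q; rewrite !inE ?nq ?Eq ?eqxx.
apply/subsetP => y; rewrite !inE => /andP[qy /eqP Ey].
by have [-> ->] := o_cone nq qy (etrans Eq (esym Ey)); rewrite Eq /=.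
Qed.

Definition top k p := iter #|T| (up k) p.

(** As [up k] is injective where it moves, two trajectories that meet are one trajectory entered at
    different points. *)
Lemma up_meet k n x y : k < 8 -> x \in A -> y \in A -> up k y = iter n (up k) x ->
  (exists m, y = iter m (up k) x) \/ exists m, x = iter m (up k) y.
Proof.
move=> k8 xA yA; case: (eqVneq (up k y) y) => [-> ->|my]; first by left; exists n.
elim: n => [|n IH]; first by move=> /= E; right; exists 1; rewrite /= E.
rewrite iterS; set z := iter n (up k) x => E.
have zA : z \in A by exact: iter_up_inA.
case: (eqVneq (up k z) z) => [Ez|mz]; first by apply: IH; rewrite E Ez.
by left; exists n; apply: (@up_inj k).
Qed.

Lemma iter_up_meet k n x y : k < 8 -> x \in A -> y \in A ->
  iter n (up k) x = iter n (up k) y ->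
  (exists m, y = iter m (up k) x) \/ exists m, x = iter m (up k) y.
Proof.
move=> k8; elim: n x y => [|n IH] x y xA yA; first by move=> /= ->; left; exists 0.
rewrite !iterSr => /IH[||[m Em]|[m Em]]; rewrite ?up_inA //.
  by apply: (@up_meet _ m.+1) => //; rewrite iterSr.
by apply/or_comm; apply: (@up_meet _ m.+1) => //; rewrite iterSr.
Qed.

Lemma top_eq k x y : k < 8 -> x \in A -> y \in A -> top k x = top k y ->
  (exists m, y = iter m (up k) x) \/ exists m, x = iter m (up k) y.
Proof. by move=> *; exact: (@iter_up_meet _ #|T|). Qed.

(** Turns membership in a common chain into a direction, which later shows that two chains cross at
    most once. *)
Lemma top_sector k x y : k < 8 -> x \in A -> y \in A -> x != y -> top k x = top k y ->
  o x y %% 8 = k.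
Proof.
move=> k8 xA yA nxy /(top_eq k8 xA yA) [[m E]|[m E]].
  have [E'|[_]] := iter_up_cone k m xA; last by rewrite -E; lia.
  by rewrite E E' eqxx in nxy.
have [E'|[ny]] := iter_up_cone k m yA; last by rewrite -E (o_rev nxy); lia.
by rewrite E E' eqxx in nxy.
Qed.

(** Chains are named by their last point, so a property has to be carried there and back. *)
Lemma top_closed (Q : T -> Prop) k x :
  (forall y z, y \in A -> z \in A -> near y z -> Q y -> Q z) ->
  x \in A -> Q x <-> Q (top k x).
Proof.
move=> Qn xA; rewrite /top; elim: #|T| => //= n IH.
have := iter_up_inA k n xA; set z := iter n _ _ in IH * => zA.
case: (upP k z) => // q qA zq _ _; split=> H.
  by apply: Qn zq _ => //; apply/IH.
by apply/IH; apply: Qn H => //; rewrite near_sym.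
Qed.

(** * Active sectors and the count at one particle *)

Definition sec (p y : T) : 'I_8 := Ordinal (ltn_pmod (o p y) (isT : 0 < 8)).
Definition active p (k : 'I_8) := [exists y in nbr p, sec p y == k].
Definition corner p :=
  [exists yw : T * T, [&& yw.1 \in nbr p, yw.2 \in nbr p & perp_sec (sec p yw.1) (sec p yw.2)]].

Lemma activeP p y : y \in nbr p -> active p (sec p y).
Proof. by move=> yp; apply/exists_inP; exists y. Qed.

(* Outside the sectors of [Y], each active sector at [p] comes from a bond cut
   at [p] from its partner in [Y]. *)
Lemma active_le p (Y : {set T}) : p \in A -> Y \subset nbr p ->
  (forall x, x \in nbr p -> x \notin Y -> exists2 y, y \in Y & 7 <= absdiff (o p x) (o p y) <= 9) ->
  2 * #|[set k | active p k]| <= 2 * #|Y| + #|[set t in cuts | t.1.2 == p]|.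
Proof.
move=> pA Yp part.
pose SY := [set sec p y | y in Y].
pose X := [set x in nbr p | sec p x \notin SY].
(* On [X] a partner exists, so the default [x] is never returned. *)
pose pr x := odflt x [pick y in Y | 7 <= absdiff (o p x) (o p y) <= 9].
have XP x : x \in X -> [/\ x \in nbr p, x \notin Y, pr x \in Y & cut_diff (o p x) (o p (pr x))].
  rewrite inE => /andP[xp xS].
  have xY : x \notin Y by apply: contra xS => xY; apply/imsetP; exists x.
  rewrite /pr; case: pickP => [y /andP[yY yx]|no] /=; last first.
    by have [y yY yx] := part _ xp xY; have := no y; rewrite yY yx.
  split => //; apply: contraT => nc.
  case/negP: xS; apply/imsetP; exists y => //; apply/val_inj => /=.
  by move: yx nc; rewrite /cut_diff /absdiff; lia.
have actS : [set k | active p k] \subset SY :|: [set sec p x | x in X].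
  apply/subsetP => k; rewrite inE => /exists_inP[y yp /eqP <-]; apply/setUP.
  case: (boolP (sec p y \in SY)) => ns; [by left | right].
  by apply: imset_f; rewrite inE yp ns.
have le1 : #|[set k | active p k]| <= #|Y| + #|X|.
  apply: (leq_trans (subset_leq_card actS)).
  apply: leq_trans; first exact: leq_of_leqif (leq_card_setU _ _).
  by apply: leq_add; apply: leq_imset_card.
suff : 2 * #|X| <= #|[set t in cuts | t.1.2 == p]| by lia.
(* Each [x] in [X] yields its cut in both orders, whence the factor 2. *)
pose f x := (x, p, pr x); pose g x := (pr x, p, x).
have cf : #|f @: X| = #|X| by apply: card_imset => x y [].
have cg : #|g @: X| = #|X| by apply: card_imset => x y [].
have disj : [disjoint f @: X & g @: X].
  rewrite -setI_eq0; apply/eqP/setP => t; rewrite !inE; apply/negP => /andP[].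
  case/imsetP=> x xX -> /imsetP[y yX [E _]].
  by have [_ xY _ _] := XP x xX; have [_ _ prY _] := XP y yX; rewrite E prY in xY.
have -> : 2 * #|X| = #|f @: X :|: g @: X|.
  by rewrite cardsU (eqP (_ : #|_ :&: _| == 0)) ?cf ?cg ?cards_eq0 ?setI_eq0 //; lia.
apply: subset_leq_card; apply/subsetP => t; rewrite !inE.
case/orP=> /imsetP[x xX ->] /=; have [xp _ prY c] := XP x xX;
  have prp := subsetP Yp _ prY; rewrite pA eqxx andbT /=.
  by move: xp prp; rewrite !inE => -> ->.
move: xp prp; rewrite !inE => -> -> /=.
by move: c; rewrite /cut_diff /absdiff; lia.
Qed.

(** The boolean terms count one-point chains: one if [p] has no crossing pair, one more if it has no
    bond. Thus [p] lies on at most two chains, except for active sectors paid for by cuts; all is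
    doubled because cuts are ordered. *)
Lemma local_count p : p \in A ->
  2 * #|[set k | active p k]| + 2 * ~~ corner p + 2 * (nbr p == set0)
    <= 4 + #|[set t in cuts | t.1.2 == p]|.
Proof.
move=> pA.
case: (boolP (corner p)) => [|nc].
  case/existsP=> -[y w] /and3P[/= yp wp yw].
  have nyw : y != w by apply: contraTneq yw => ->; rewrite /perp_sec /absdiff; lia.
  have -> : (nbr p == set0) = false by apply/negP => /eqP E; rewrite E inE in yp.
  (* Two perpendicular bonds serve as representatives: any other neighbour is nearly opposite to one
     of them. *)
  have : 2 * #|[set k | active p k]| <= 2 * #|[set y; w]| + #|[set t in cuts | t.1.2 == p]|.
    apply: active_le => //; first by apply/subsetP => x /set2P[] ->.
    move=> x xp; rewrite !inE negb_or => /andP[xy xw].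
    have := o_good pA xp yp xy; have := o_good pA xp wp xw; have := o_good pA yp wp nyw.
    move: (o_lt p x) (o_lt p y) (o_lt p w) yw; rewrite /perp_sec /right_diff /absdiff /= => *.
    case: (boolP (7 <= absdiff (o p x) (o p y) <= 9)) => c1.
      by exists y; rewrite ?set21.
    exists w; rewrite ?set22 //; move: c1; rewrite /absdiff; lia.
  by rewrite cards2 nyw /=; lia.
case: (set_0Vmem (nbr p)) => [E|[y yp]].
  rewrite E eqxx; suff -> : #|[set k | active p k]| = 0 by lia.
  apply/eqP; rewrite cards_eq0; apply/eqP/setP => k; rewrite !inE.
  by apply/exists_inP => -[y]; rewrite E inE.
have -> : (nbr p == set0) = false by apply/negP => /eqP E; rewrite E inE in yp.
have : 2 * #|[set k | active p k]| <= 2 * #|[set y]| + #|[set t in cuts | t.1.2 == p]|.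
  apply: active_le => //; first by rewrite sub1set.
  move=> x xp; rewrite inE => xy; exists y; first by rewrite inE.
  have : ~~ perp_sec (sec p x) (sec p y).
    by apply: contra nc => c; apply/existsP; exists (x, y); rewrite /= xp yp c.
  have := o_good pA xp yp xy; move: (o_lt p x) (o_lt p y).
  by rewrite /perp_sec /right_diff /absdiff /=; lia.
by rewrite cards1; lia.
Qed.

Lemma card_fiber (U : finType) (f : U -> T) (B : {set U}) : (forall u, u \in B -> f u \in A) ->
  #|B| = \sum_(p in A) #|[set u in B | f u == p]|.
Proof.
move=> fB; rewrite -sum1_card (partition_big f (mem A)) //=.
apply: eq_bigr => p _; rewrite -sum1_card; apply: eq_bigl => u.
by rewrite inE.
Qed.

(** * The graph of chains *)

Definition chainT : finType := ((T * 'I_8) + (T * bool))%type.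

(** A chain is named by its last point and its sector. [inr (p, false)] is the one-point chain
    through a particle without crossing pair, [inr (p, true)] the second one through an isolated
    particle. *)
Definition vertices : {set chainT} :=
  [set v : chainT | match v with
    | inl (q, k) => [&& q \in A, active q k & up k q == q]
    | inr (p, false) => (p \in A) && ~~ corner p
    | inr (p, true) => (p \in A) && (nbr p == set0)
    end].

(** Oriented into sectors 0 to 7, a bond is a proper move of [up], determined by its starting point
    and sector; the factor 2 restores the other orientation. *)
Lemma card_bonds : #|bonds| <= 2 * #|[set qk : T * 'I_8 |
    (qk.1 \in A) && (active qk.1 qk.2 && (up qk.2 qk.1 != qk.1))]|.
Proof.
pose pos := [set t in bonds | o t.1 t.2 < 8].
have nb t : t \in bonds -> t.1 != t.2 by rewrite inE => /and3P[_ _ /near_neq].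
have : #|bonds| <= 2 * #|pos|.
  rewrite -(cardsID [set t | o t.1 t.2 < 8] bonds) -setIdE mulSn mul1n leq_add2l.
  pose sw (t : T * T) := (t.2, t.1).
  have <- : #|sw @: (bonds :\: [set t | o t.1 t.2 < 8])| = #|bonds :\: [set t | o t.1 t.2 < 8]|.
    by apply: card_imset => -[a b] [c d] [-> ->].
  apply: subset_leq_card; apply/subsetP => _ /imsetP[t /setDP[tb ot] ->].
  move: ot (o_rev (nb _ tb)) (o_lt t.1 t.2); rewrite !inE /= => ot -> lt.
  move: tb; rewrite inE near_sym => /and3P[-> -> ->] /=.
  by lia.
move/leq_trans; apply; rewrite leq_mul2l /=.
pose f (t : T * T) := (t.1, sec t.1 t.2).
have <- : #|f @: pos| = #|pos|.
  apply: card_in_imset => -[p q] [p' q']; rewrite !inE /= => /andP[/and3P[pA qA pq] o8].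
  case/andP=> /and3P[_ q'A p'q'] o8' [E1 E2]; subst p'; congr pair.
  by apply: (@o_inj p); rewrite ?nbr_A //; move: E2 o8 o8'; lia.
apply: subset_leq_card; apply/subsetP => _ /imsetP[[p q] + ->].
rewrite !inE /= => /andP[/and3P[pA qA pq] o8].
rewrite pA activeP ?nbr_A //= modn_small // (upE pA qA pq) // eq_sym.
exact: near_neq.
Qed.

(** An active particle-sector pair either ends its chain and names a vertex, or moves on and
    accounts for a bond; summing [local_count] bounds the number of pairs. *)
Lemma card_vertices : 2 * #|vertices| + #|bonds| <= 4 * #|A| + #|cuts|.
Proof.
pose act := [set qk : T * 'I_8 | (qk.1 \in A) && active qk.1 qk.2].
pose mv := [set qk : T * 'I_8 | up qk.2 qk.1 != qk.1].
pose n1 := [set p in A | ~~ corner p]; pose n0 := [set p in A | nbr p == set0].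
have Vle : #|vertices| <= #|act :\: mv| + (#|n1| + #|n0|).
  pose i0 (x : T * 'I_8) : chainT := inl x.
  pose i1 (x : T) : chainT := inr (x, false); pose i2 (x : T) : chainT := inr (x, true).
  have sV : vertices \subset i0 @: (act :\: mv) :|: (i1 @: n1 :|: i2 @: n0).
    apply/subsetP => -[[q k]|[p [|]]]; rewrite inE.
    - case/and3P=> qA a u; apply/setUP; left; apply: imset_f.
      by rewrite !inE /= negbK u qA a.
    - by move=> pp; apply/setUP; right; apply/setUP; right; apply: imset_f; rewrite inE.
    - by move=> pp; apply/setUP; right; apply/setUP; left; apply: imset_f; rewrite inE.
  apply: leq_trans (subset_leq_card sV) _.
  apply: leq_trans; first exact: leq_of_leqif (leq_card_setU _ _).
  apply: leq_add; first exact: leq_imset_card.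
  apply: leq_trans; first exact: leq_of_leqif (leq_card_setU _ _).
  by apply: leq_add; exact: leq_imset_card.
have Ble : #|bonds| <= 2 * #|act :&: mv|.
  apply: leq_trans card_bonds _; rewrite leq_mul2l /= subset_leq_card //.
  by apply/subsetP => qk; rewrite !inE => /and3P[-> -> ->].
have Ea := cardsID mv act.
have Eact : #|act| = \sum_(p in A) #|[set k | active p k]|.
  rewrite (@card_fiber _ fst); last by move=> u; rewrite inE => /andP[].
  apply: eq_bigr => p pA.
  have pk_inj : injective (pair p : 'I_8 -> T * 'I_8) by move=> k l [].
  rewrite -(card_imset _ pk_inj); apply: eq_card => -[q k].
  rewrite !inE /=; apply/idP/imsetP => [/andP[/andP[_ a] /eqP E]|[l]].
    by exists k; rewrite ?inE -?E.
  by rewrite inE => a [-> ->]; rewrite pA a eqxx.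
have E1 : #|n1| = \sum_(p in A) ~~ corner p.
  rewrite -sum1_card big_mkcond [RHS]big_mkcond; apply: eq_bigr => p _.
  by rewrite inE; case: (p \in A) => //; case: corner.
have E0 : #|n0| = \sum_(p in A) (nbr p == set0).
  rewrite -sum1_card big_mkcond [RHS]big_mkcond; apply: eq_bigr => p _.
  by rewrite inE; case: (p \in A) => //; case: eqP.
have Ec : #|cuts| = \sum_(p in A) #|[set t in cuts | t.1.2 == p]|.
  by apply: card_fiber => t; rewrite inE => /andP[].
have : 2 * #|act| + 2 * #|n1| + 2 * #|n0| <= 4 * #|A| + #|cuts|.
  rewrite Eact E1 E0 Ec (_ : 4 * #|A| = \sum_(p in A) 4); last by rewrite sum_nat_const mulnC.
  rewrite !big_distrr -!big_split /=; apply: leq_sum => p; exact: local_count.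
by lia.
Qed.

Definition chain (p : T) (k : 'I_8) : chainT := inl (top k p, k).
Definition loose (p : T) (b : bool) : chainT := inr (p, b).

(** The two chains through [p], one-point chains filling the missing places; if several crossing
    pairs exist, any one serves. *)
Definition edge (p : T) : chainT * chainT :=
  if [pick yw : T * T | [&& yw.1 \in nbr p, yw.2 \in nbr p & perp_sec (sec p yw.1) (sec p yw.2)]]
    is Some yw then (chain p (sec p yw.1), chain p (sec p yw.2)) else
  if [pick y in nbr p] is Some y then (chain p (sec p y), loose p false)
  else (loose p false, loose p true).

Variant edge_spec (p : T) : chainT * chainT -> Prop :=
  | EdgeCross k l of active p k & active p l & perp_sec k l :
      edge_spec p (chain p k, chain p l)
  | EdgeLine k of active p k & ~~ corner p : edge_spec p (chain p k, loose p false)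
  | EdgeIso of nbr p = set0 & ~~ corner p : edge_spec p (loose p false, loose p true).

Lemma edgeP p : edge_spec p (edge p).
Proof.
rewrite /edge; case: pickP => [[y w] /= /and3P[yp wp c]|nc].
  by apply: EdgeCross; rewrite ?activeP.
have {}nc : ~~ corner p by apply/existsPn => yw; rewrite nc.
case: pickP => [y yp|no]; first by apply: EdgeLine; rewrite ?activeP.
by apply: EdgeIso => //; apply/setP => y; rewrite no inE.
Qed.

(** If the chain moves at all, its last point is still active, because the bond leading back has the
    same sector modulo 8. *)
Lemma chain_vertex p k : p \in A -> active p k -> chain p k \in vertices.
Proof.
move=> pA a; rewrite inE /=; apply/and3P; split; first exact: iter_up_inA.
  rewrite /top; elim: #|T| => //= n IH.
  have := iter_up_inA k n pA; set z := iter n _ _ in IH * => zA.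
  case: (upP k z) => // q qA zq nzq Eq.
  apply/exists_inP; exists z; first by rewrite nbr_A // near_sym.
  by apply/eqP/val_inj; rewrite /= (o_rev nzq) Eq; move: (ltn_ord k); lia.
by apply/eqP; exact: iter_up_stable.
Qed.

Lemma edge_vertex p : p \in A -> (edge p).1 \in vertices /\ (edge p).2 \in vertices.
Proof.
move=> pA; case: edgeP => [k l ak al _|k ak nc|E nc] /=.
- by rewrite !chain_vertex.
- by split; [exact: chain_vertex | rewrite inE /= pA].
- by split; rewrite inE /= pA ?E ?eqxx.
Qed.

(** Two distinct common points would see each other in both sectors. *)
Lemma chain2_inj p q (k l : 'I_8) : p \in A -> q \in A -> perp_sec k l ->
  top k p = top k q -> top l p = top l q -> p = q.
Proof.
move=> pA qA kl Ek El; case: (eqVneq p q) => // npq.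
have := top_sector (ltn_ord k) pA qA npq Ek.
have := top_sector (ltn_ord l) pA qA npq El.
by move: kl; rewrite /perp_sec /absdiff /=; lia.
Qed.

Lemma perp_secC k l : perp_sec k l = perp_sec l k.
Proof. by rewrite /perp_sec /absdiff addnC. Qed.

Lemma edge_inj p q : p \in A -> q \in A -> (edge p).1 = (edge q).1 -> (edge p).2 = (edge q).2 ->
  p = q.
Proof.
move=> pA qA; case: edgeP => [k l _ _ kl|k _ _|_ _]; case: edgeP => [k' l' _ _ kl'|k' _ _|_ _] //=.
- by move=> [E1 E1'] [E2 E2']; subst k' l'; exact: (@chain2_inj p q k l).
- by move=> _ [].
- by move=> [].
Qed.

Lemma edge_inj_swap p q : p \in A -> q \in A ->
  (edge p).1 = (edge q).2 -> (edge p).2 = (edge q).1 ->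
  p = q.
Proof.
move=> pA qA; case: edgeP => [k l _ _ kl|k _ _|_ _]; case: edgeP => [k' l' _ _ kl'|k' _ _|_ _] //=.
by move=> [E1 E1'] [E2 E2']; subst k' l'; exact: (@chain2_inj p q k l).
Qed.

Notation eadj := (adj A (fun p => (edge p).1) (fun p => (edge p).2)).

Lemma adj_chain k l t s : eadj (inl (t, k)) (inl (s, l)) -> perp_sec (k : 'I_8) (l : 'I_8).
Proof.
case/exists_inP=> p pA; case: edgeP => [k' l' _ _ kl|k' _ _|_ _] //=.
- case/orP=> /andP[/eqP[_ <-] /eqP[_ <-]] //; by rewrite perp_secC.
- by rewrite !andbF.
Qed.

Lemma edge_loose p q b : q \in A ->
  (edge q).1 = loose p b \/ (edge q).2 = loose p b -> q = p.
Proof. by move=> qA; case: edgeP => [k l _ _ _|k _ _|_ _] /= [] // []. Qed.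

Lemma edge_neq p : (edge p).1 != (edge p).2.
Proof.
case: edgeP => [k l _ _ kl|k _ _|_ _] /=; last by apply/eqP; case.
  by apply: contraTneq kl => -[_ ->]; rewrite /perp_sec /absdiff; lia.
by [].
Qed.

Lemma adj_irr v : ~~ eadj v v.
Proof.
apply/exists_inPn => p _; rewrite orbb; apply/negP => /andP[/eqP E /eqP E'].
by have := edge_neq p; rewrite E E' eqxx.
Qed.

Lemma adj_loose p b v : eadj (loose p b) v ->
  v = if (edge p).1 == loose p b then (edge p).2 else (edge p).1.
Proof.
case/exists_inP=> q qA /orP[/andP[/eqP E1 /eqP E2]|/andP[/eqP E1 /eqP E2]].
  have Eq := edge_loose qA (or_introl E1); subst q.
  by rewrite E1 eqxx.
have Eq := edge_loose qA (or_intror E2); subst q.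
by rewrite -{1}E2 (negbTE (edge_neq p)).
Qed.

(** Three numbers below 8 cannot differ pairwise by 3 to 5, and a one-point chain has only one
    neighbour. *)
Lemma edge_triangle_free v u w : eadj v u -> eadj v w -> ~~ eadj u w.
Proof.
move=> vu vw; apply/negP => uw.
have same x y z : eadj x y -> eadj x z -> eadj y z -> (exists p b, x = loose p b) -> False.
  move=> xy xz yz [p [b E]]; subst x.
  move: yz; rewrite (adj_loose xy) (adj_loose xz).
  by apply/negP; exact: adj_irr.
case: v vu vw => [[t k]|[p b]] vu vw; last by apply: (same _ _ _ vu vw uw); exists p, b.
case: u vu uw => [[t' l]|[p b]] vu uw; last first.
  by rewrite adjC in vu; apply: (same _ _ _ vu uw vw); exists p, b.
case: w vw uw => [[t'' m]|[p b]] vw uw; last first.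
  rewrite adjC in vw; rewrite adjC in uw.
  by apply: (same _ _ _ vw uw vu); exists p, b.
have := adj_chain vu; have := adj_chain vw; have := adj_chain uw.
by rewrite /perp_sec /absdiff; lia.
Qed.

(** * Chains bonded to the substrate *)

Definition anchored : {set chainT} := [set chain t.1 (sec t.1 t.2) | t in contacts].

Lemma contact_dir p z : p \in A -> z \in sub -> near p z ->
  (c0 + 7 <= o p z <= c0 + 9) /\ c0.-1 <= sec p z <= c0.+1.
Proof.
move=> pA zs pz; have := o_sub pA zs pz.
have := o_rev (near_neq pz) => /= ->.
by move: (o_lt p z) c0_range; lia.
Qed.

Lemma iter_up_pred k n p : p \in A -> iter n (up k) p = p \/
  exists q, [/\ q \in A, near q (iter n (up k) p), q != iter n (up k) p
             & o q (iter n (up k) p) = k].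
Proof.
move=> pA; elim: n => [|n IH] /=; first by left.
have zA := iter_up_inA k n pA.
case: (upP k (iter n (up k) p)) => // q qA zq nzq Eq.
by right; exists (iter n (up k) p).
Qed.

(** A chain cannot touch the substrate twice: the later of two touching particles would have its
    contact and its predecessor in the chain in the same sector, although these are different
    neighbours. *)
Lemma anchored_inj : {in contacts &, injective (fun t => chain t.1 (sec t.1 t.2))}.
Proof.
have H p z p' z' : p \in A -> z \in sub -> near p z -> p' \in A -> z' \in sub -> near p' z' ->
    sec p z = sec p' z' -> (exists m, p' = iter m (up (sec p z)) p) -> p' = p.
  move=> pA zs pz p'A z's p'z' Es [m Em].
  have := iter_up_pred (sec p z) m pA; rewrite -Em; case=> // -[q [qA qp' nqp' Eq]].
  suff E : q = z' by have := A_sub qA; rewrite E z's.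
  apply: (@o_inj p') => //; [by rewrite nbr_A // near_sym | by rewrite nbr_sub |].
  (* By the range of [c0] the direction to a contact has index 8 to 15, so its sector modulo 8
     determines it. *)
  have [+ _] := contact_dir p'A z's p'z'.
  rewrite (o_rev nqp') Eq Es /=; move: c0_range; clear; lia.
move=> [p z] [p' z']; rewrite !inE /= => /and3P[pA zs pz] /and3P[p'A z's p'z'].
case=> Et Es; have Ep : p = p'.
  have Es' : sec p z = sec p' z' by apply/val_inj.
  have Et' : top (sec p z) p = top (sec p z) p' by rewrite Et Es'.
  case: (top_eq (ltn_ord (sec p z)) pA p'A Et').
    by move/(H _ _ _ _ pA zs pz p'A z's p'z' Es').
  by rewrite Es' => /(H _ _ _ _ p'A z's p'z' pA zs pz (esym Es')).
subst p'; congr pair; apply/eqP/contraT.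
move/(o_good pA (nbr_sub zs pz) (nbr_sub z's p'z')).
have [+ _] := contact_dir pA zs pz; have [+ _] := contact_dir pA z's p'z'.
by rewrite /right_diff /absdiff; lia.
Qed.

Lemma card_contacts : #|contacts| <= #|A|.
Proof.
have <- : #|fst @: contacts| = #|contacts|.
  apply: card_in_imset => -[p z] [p' z'] pz p'z' /= E; subst p'.
  move: pz p'z'; rewrite !inE /= => /and3P[pA zs pz] /and3P[_ z's pz'].
  congr pair; apply/eqP/contraT.
  move/(o_good pA (nbr_sub zs pz) (nbr_sub z's pz')).
  have [+ _] := contact_dir pA zs pz; have [+ _] := contact_dir pA z's pz'.
  by rewrite /right_diff /absdiff; lia.
apply: subset_leq_card; apply/subsetP => _ /imsetP[t + ->].
by rewrite inE => /andP[].
Qed.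

(** Anchored chains have sectors within one of [c0], hence are never perpendicular. *)
Lemma anchored_indep : indep A vertices (fun p => (edge p).1) (fun p => (edge p).2) anchored.
Proof.
apply/andP; split.
  apply/subsetP => _ /imsetP[[p z] + ->]; rewrite inE => /and3P[/= pA zs pz].
  by rewrite chain_vertex // activeP // nbr_sub.
apply/forall_inP => _ /imsetP[[p z] + ->]; rewrite inE => /and3P[/= pA zs pz].
apply/forall_inP => _ /imsetP[[p' z'] + ->]; rewrite inE => /and3P[/= p'A z's p'z'].
apply/negP => /adj_chain.
have [_ +] := contact_dir pA zs pz; have [_ +] := contact_dir p'A z's p'z'.
by rewrite /perp_sec /absdiff; lia.
Qed.

(** From a contact, [Q] travels along an anchored chain to a crossing, and from there along a second
    chain to [p]. *)
Lemma anchored_reach (Q : T -> Prop) :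
  (forall p q, p \in A -> q \in A -> near p q -> Q p -> Q q) ->
  (forall p z, p \in A -> z \in sub -> near p z -> Q p) ->
  (forall v, v \in vertices -> v \in anchored \/ exists2 u, u \in anchored & eadj v u) ->
  forall p, p \in A -> Q p.
Proof.
move=> Qn Q0 dom p pA.
have Qtop (k : 'I_8) x y : x \in A -> y \in A -> top k x = top k y -> Q x -> Q y.
  move=> xA yA E /(top_closed k Qn xA); rewrite E => Qy.
  by apply/(top_closed k Qn yA).
have Qanch q v : q \in A -> v \in anchored -> (edge q).1 = v \/ (edge q).2 = v -> Q q.
  move=> qA /imsetP[[p' z'] + ->]; rewrite inE => /and3P[/= p'A z's p'z'].
  have Qp' := Q0 _ _ p'A z's p'z'.
  case: edgeP => [k l _ _ _|k _ _|_ _] /= [] // [E Es];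
    by apply: (Qtop (sec p' z') p'); rewrite // -E -Es.
have [e1 _] := edge_vertex pA.
case: (dom _ e1) => [/Qanch|[u uS]]; first by apply=> //; left.
case/exists_inP=> q qA Hq.
have Qq : Q q by case/orP: Hq => /andP[/eqP E1 /eqP E2]; apply: (Qanch q u); auto.
have {Hq} : (edge q).1 = (edge p).1 \/ (edge q).2 = (edge p).1.
  by case/orP: Hq => /andP[/eqP E1 /eqP E2]; auto.
case: (edgeP p) => [k l _ _ _|k _ _|_ _] /= H; last by rewrite -(edge_loose qA H).
all: case: edgeP H => [k' l' _ _ _|k' _ _|_ _] /= [] // [Et Ek]; subst;
  exact: Qtop qA pA Et Qq.
Qed.

(** [n] counts the chains and [a] is the independence number of their graph; the last clause states
    domination by the anchored chains as an induction principle. *)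
Theorem chain_count : exists n a : nat,
  [/\ [/\ #|contacts| <= a, a <= n & #|contacts| <= #|A|], #|A| <= (n - a) * a,
     2 * n + #|bonds| <= 4 * #|A| + #|cuts| &
     #|contacts| = a -> forall Q : T -> Prop,
       (forall p q, p \in A -> q \in A -> near p q -> Q p -> Q q) ->
       (forall p z, p \in A -> z \in sub -> near p z -> Q p) ->
       forall p, p \in A -> Q p].
Proof.
have Es : #|anchored| = #|contacts| by apply: card_in_imset; exact: anchored_inj.
have [||||||a [sa aV Na dom]] := @triangle_free_bound _ _ A vertices anchored
    (fun p => (edge p).1) (fun p => (edge p).2).
- by move=> p /edge_vertex[].
- by move=> p /edge_vertex[].
- exact: edge_inj.
- exact: edge_inj_swap.
- exact: edge_triangle_free.
- exact: anchored_indep.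
exists #|vertices|, a; split=> //.
- by rewrite -Es; split=> //; rewrite Es; exact: card_contacts.
- exact: card_vertices.
- by rewrite -Es => /dom D Q Qn Q0; exact: anchored_reach.
Qed.

End Chains.

(** * Minimisation over rectangles *)

Section Optimization.
Variables (R : realType) (beta : R).
Local Open Scope ring_scope.
Hypothesis beta_gt0 : 0 < beta.
Implicit Types N h : nat.

Lemma mbeta_le N h : (0 < h <= N)%N -> mbeta beta N <= Defs.mfun beta N h.
Proof.
move=> hN; rewrite /mbeta; by apply: ge_bigmin_seq; rewrite ?mem_index_iota ?ltnS.
Qed.

Lemma mbeta_attained N : (0 < N)%N -> exists2 h, (0 < h <= N)%N & mbeta beta N = Defs.mfun beta N h.
Proof.
move=> N0; rewrite /mbeta big_nat; elim/big_ind : _ => [|x y [h hN ->] [k kN ->]|h hN].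
- by exists 1%N.
- by rewrite /Order.min; case: ifP => _; [exists h | exists k].
- by exists h.
Qed.

Lemma hstar_ge N h : (0 < h <= N)%N -> Defs.mfun beta N h <= mbeta beta N -> (h <= hstar beta N)%N.
Proof.
move=> hN le; rewrite /hstar; apply: (@leq_bigmax_seq _ _ _ id) => //.
  by rewrite mem_index_iota ltnS.
by rewrite eq_le le mbeta_le.
Qed.

Lemma ceil_div_le N h w : (0 < h)%N -> (N <= h * w)%N ->
  (Num.ceil (N%:R / h%:R : R))%:~R <= w%:R :> R.
Proof.
move=> h0 Nhw; have h0' : 0 < h%:R :> R by rewrite ltr0n.
have : Num.ceil (N%:R / h%:R : R) <= w%:Z.
  by rewrite ceil_le_int ler_pdivrMr // -pmulrn -natrM ler_nat mulnC.
by rewrite -(ler_int R) -pmulrn.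
Qed.

Lemma mfun_le N h w : beta <= 1 -> (0 < h)%N -> (N <= h * w)%N ->
  Defs.mfun beta N h <= 2 * h%:R + 2 * (1 - beta) * w%:R.
Proof.
move=> b1 h0 Nhw; rewrite lerD2l ler_wpM2l ?ceil_div_le //; lra.
Qed.

Lemma mfun1 N : Defs.mfun beta N 1 = 2 + 2 * (1 - beta) * N%:R.
Proof. by rewrite /Defs.mfun divr1 mulr1 -[N%:R]/(N%:Z%:~R) intrKceil. Qed.

(** With the optimal [h] kept, the ceiling grows by at most one. The constant 4 makes
    [- 2 * N + mbeta / 2] strictly decreasing in [N]. *)
Lemma mbeta_step N : (0 < N)%N -> mbeta beta N.+1 < mbeta beta N + 4.
Proof.
move=> N0; have [h /andP[h0 hN] ->] := mbeta_attained N0.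
have {hN}hN : (0 < h <= N.+1)%N by rewrite h0 ltnW.
apply: le_lt_trans (mbeta_le hN) _; rewrite /Defs.mfun -addrA ltrD2l.
have h0' : 0 < h%:R :> R by rewrite ltr0n.
have le1 : Num.ceil (N%:R / h%:R : R) <= Num.ceil (N.+1%:R / h%:R : R).
  by apply: le_ceil; rewrite ler_pM2r ?invr_gt0 // ler_nat.
have le2 : Num.ceil (N.+1%:R / h%:R : R) <= Num.ceil (N%:R / h%:R : R) + 1.
  rewrite ceil_le_int intrD -natr1 mulrDl lerD ?ceil_ge //.
  by rewrite ler_pdivrMr // mul1r ler1n.
have {}le1 : (Num.ceil (N%:R / h%:R : R))%:~R <= (Num.ceil (N.+1%:R / h%:R : R))%:~R :> R.
  by rewrite ler_int.
have {}le2 :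
  (Num.ceil (N.+1%:R / h%:R : R))%:~R <= (Num.ceil (N%:R / h%:R : R))%:~R + 1 :> R.
  by rewrite -[X in _ <= _ + X]/(1%:~R) -intrD ler_int.
move: le1 le2; set x := (X in X <= _); set y := (X in _ <= X) => le1 le2.
move: beta_gt0; nra.
Qed.

(** Since [s <= a], the quantity is at least [h + (1 - beta) * w] with [h = n - a], [w = a] and
    [N <= h * w]. For [beta < 1] this is compared with [mfun] at [h]; for [beta >= 1] the comparison
    is with height 1. *)
Lemma chain_optimum N n a s : (0 < N)%N -> (s <= a <= n)%N -> (s <= N)%N -> (N <= (n - a) * a)%N ->
  2^-1 * mbeta beta N <= n%:R - beta * s%:R /\
  (n%:R - beta * s%:R <= 2^-1 * mbeta beta N -> s = a /\ (N%:R / (hstar beta N)%:R : R) <= s%:R).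
Proof.
move=> N0 /andP[sa an] sN Nna.
have na0 : (0 < n - a)%N by lia.
have a0 : (0 < a)%N by lia.
have nE : n%:R = (n - a)%:R + a%:R :> R by rewrite -natrD subnK.
have sa' : s%:R <= a%:R :> R by rewrite ler_nat.
have sN' : s%:R <= N%:R :> R by rewrite ler_nat.
have na1 : 1 <= (n - a)%:R :> R by rewrite ler1n.
have a1 : 1 <= a%:R :> R by rewrite ler1n.
have ba : beta * s%:R <= beta * a%:R by rewrite ler_pM2l.
case: (leP 1 beta) => b1.
  have := @mbeta_le N 1; rewrite N0 mfun1 => /(_ isT) m1.
  have bs : (beta - 1) * s%:R <= (beta - 1) * N%:R by rewrite ler_wpM2l // subr_ge0.
  split; first by rewrite nE; nra.
  rewrite nE => le.
  have sa_eq : s = a.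
    apply/eqP; rewrite eqn_leq sa -(ler_nat R); lra.
  subst s; split => //.
  (* For [beta > 1] equality forces [s = N]; for [beta = 1] it forces [n - a = 1], and the area
     bound gives the same. *)
  have N_le : (N <= a)%N.
    case: (ltP 1 beta) => b1'.
      rewrite -(ler_nat R) -(ler_pM2l (_ : 0 < beta - 1)) ?subr_gt0 //; lra.
    have beta1 : beta = 1 by apply/le_anti; rewrite b1 b1'.
    have na1' : (n - a <= 1)%N by rewrite -(ler_nat R); rewrite beta1 in le m1; lra.
    by apply: leq_trans Nna _; rewrite -[leqRHS]mul1n leq_mul2r na1' orbT.
  have NaR : N%:R <= a%:R :> R by rewrite ler_nat.
  (* The quotient by zero is zero by convention. *)
  case: (posnP (hstar beta N)) => [->|h0]; first by rewrite invr0 mulr0.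
  by rewrite ler_pdivrMr ?ltr0n //; apply: le_trans NaR _; rewrite ler_peMr // ler1n.
(* Heights above [N] are not admissible in [mbeta]; they are strictly worse than height [N]. *)
case: (leqP (n - a) N) => naN; last first.
  have := @mbeta_le N N; rewrite N0 leqnn => /(_ isT) mN.
  have := @mfun_le N N 1 (ltW b1) N0; rewrite muln1 leqnn => /(_ isT) mN'.
  have naN' : N%:R + 1 <= (n - a)%:R :> R by rewrite natr1 ler_nat.
  have bb : (1 - beta) * 1 <= (1 - beta) * a%:R by rewrite ler_wpM2l // subr_ge0 ltW.
  split=> [|le]; first by rewrite nE; lra.
  by exfalso; rewrite nE in le; lra.
have hN : (0 < n - a <= N)%N by rewrite na0.
have := mbeta_le hN => m1; have := mfun_le (ltW b1) na0 Nna => m2.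
split; first by rewrite nE; lra.
rewrite nE => le.
have sa_eq : s = a.
  apply/eqP; rewrite eqn_leq sa -(ler_nat R) -(ler_pM2l beta_gt0); lra.
split=> //; subst s.
have hs : (n - a <= hstar beta N)%N by apply: hstar_ge => //; lra.
have h0 : (0 < hstar beta N)%N by apply: leq_trans hs.
rewrite ler_pdivrMr ?ltr0n // -natrM ler_nat; apply: leq_trans Nna _.
by rewrite mulnC leq_mul2l hs orbT.
Qed.
End Optimization.

(** * Shifting the sectors *)

Section Averaging.
Variable R : realType.
Local Open Scope ring_scope.

(** Different floors mean that an integer [n] lies between the shifted numbers, so [M * n + k] lies
    between [M * a] and [M * b]; distinct [k < M] give distinct such integers. *)
Lemma floor_shift_count (M : nat) (a b : R) : (0 < M)%N ->
  #|[set k : 'I_M | Num.floor (a - k%:R / M%:R) != Num.floor (b - k%:R / M%:R)]|%:R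
    <= M%:R * `|a - b| + 2.
Proof.
wlog ab : a b / a <= b.
  move=> H M0; case: (leP a b) => [|/ltW] /H /(_ M0) //.
  rewrite distrC => le; apply: le_trans le.
  by rewrite ler_nat; apply/eq_leq/eq_card => k; rewrite !inE eq_sym.
move=> M0; have M0' : 0 < M%:R :> R by rewrite ltr0n.
set S := [set k | _]%SET.
pose fa := Num.floor (M%:R * a); pose fb := Num.floor (M%:R * b).
have fab : fa <= fb by apply: le_floor; rewrite ler_pM2l.
pose L : nat := `|fb - fa|%N.
pose idx (k : 'I_M) : int := M%:Z * Num.floor (b - k%:R / M%:R) + k%:Z.
have idxP k : k \in S -> fa < idx k <= fb.
  rewrite inE => ne.
  have lt : Num.floor (a - k%:R / M%:R) < Num.floor (b - k%:R / M%:R).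
    by rewrite lt_neqAle ne le_floor // lerB.
  rewrite /fa /fb floor_lt_int floor_ge_int /idx intrD intrM -!pmulrn; apply/andP; split.
    move: lt; rewrite floor_lt_int -(ltr_pM2l M0') mulrBr mulrCA divff ?gt_eqF // mulr1; lra.
  have : (Num.floor (b - k%:R / M%:R))%:~R <= b - k%:R / M%:R by exact: floor_le_tmp.
  by rewrite -(ler_pM2l M0') mulrBr mulrCA divff ?gt_eqF // mulr1; lra.
have idx_inj : {in S &, injective (fun k => inord `|idx k - fa|%N : 'I_L.+1)}.
  move=> k l kS lS /(congr1 val); have := idxP k kS; have := idxP l lS => kP lP.
  rewrite /= !inordK; try by rewrite /L; lia.
  move=> E; have {}E : idx k = idx l by lia.
  apply/val_inj; move: E; rewrite /idx /=.
  move: (Num.floor _) (Num.floor _) (ltn_ord k) (ltn_ord l) => x y kM lM E.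
  case: (ltgtP x y) => xy; [nia | nia |]; rewrite xy in E; lia.
have : (#|S| <= L.+1)%N.
  by rewrite -(card_in_imset idx_inj) -[X in (_ <= X)%N]card_ord max_card.
rewrite -(ler_nat R) => /le_trans; apply.
have -> : L.+1%:R = fb%:~R - fa%:~R + 1 :> R.
  by rewrite -natr1 -intrB /L -[X in X + 1]/((`|fb - fa|%N : int)%:~R) gez0_abs ?subr_ge0.
rewrite distrC ger0_norm ?subr_ge0 //.
have := floor_itv (M%:R * a); have := floor_itv (M%:R * b); rewrite -/fa -/fb !intrD; lra.
Qed.

(* Averaging over the shifts [k / M] for [M] large; the count is an integer, so
   an average below [c + 1] gives a shift with count at most [c]. *)
Lemma floor_shift (J : finType) (P : {set J}) (a b : J -> R) : exists s : R,
  [/\ 0 <= s, s < 1 &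
  #|[set j in P | Num.floor (a j - s) != Num.floor (b j - s)]|%:R <= \sum_(j in P) `|a j - b j|].
Proof.
set D := \sum_(j in P) _; have D0 : 0 <= D by apply: sumr_ge0.
pose c := Num.trunc D; have /andP[cD Dc] : c%:R <= D < c.+1%:R by apply: truncn_itv.
(* Large enough that the rounding errors, 2 per index, stay below the gap [c.+1 - D] after division
   by [M]. *)
pose M := (Num.trunc (2 * #|P|%:R / (c.+1%:R - D) : R)).+1.
have M0 : 0 < M%:R :> R by rewrite ltr0n.
have MP : 2 * #|P|%:R < M%:R * (c.+1%:R - D).
  rewrite -ltr_pdivrMr ?subr_gt0 //; apply: truncnS_gt.
pose split k j := Num.floor (a j - k%:R / M%:R) != Num.floor (b j - k%:R / M%:R).
pose cnt (k : 'I_M) := #|[set j in P | split k j]|.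
have [k ck|all_gt] := pickP (fun k => cnt k <= c)%N.
  exists (k%:R / M%:R); split; first by rewrite divr_ge0.
    by rewrite ltr_pdivrMr // mul1r ltr_nat.
  by apply: le_trans cD; rewrite ler_nat.
have : (\sum_(k < M) c.+1 <= \sum_(k < M) cnt k)%N.
  by apply: leq_sum => k _; rewrite ltnNge all_gt.
have -> : (\sum_(k < M) cnt k = \sum_(j in P) #|[set k : 'I_M | split k j]|)%N.
  rewrite (eq_bigr (fun k : 'I_M => \sum_(j in P) split k j)%N).
    rewrite exchange_big /=; apply: eq_bigr => j _.
    by rewrite -sum1_card [RHS]big_mkcond; apply: eq_bigr => k _; rewrite inE; case: (split _ _).
  move=> k _; rewrite /cnt -sum1_card big_mkcond [RHS]big_mkcond; apply: eq_bigr => j _.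
  by rewrite inE; case: (j \in P) => //; case: (split _ _).
rewrite sum_nat_const card_ord -(ler_nat R) natrM natr_sum => le.
have : \sum_(j in P) (#|[set k : 'I_M | split k j]|)%:R
    <= M%:R * D + 2 * #|P|%:R :> R.
  have -> : M%:R * D + 2 * #|P|%:R = \sum_(j in P) (M%:R * `|a j - b j| + 2).
    by rewrite big_split /= sumr_const -mulr_sumr mulr_natr.
  by apply: ler_sum => j _; apply: floor_shift_count.
by lra.
Qed.
End Averaging.

(** * Directions and sectors *)

Section Directions.
Variable R : realType.
Local Open Scope ring_scope.
Implicit Types (u w : R * R) (n m : int).

Lemma periodicz (U V : zmodType) (f : U -> V) (t : U) n a :
  periodic f t -> f (a + t *~ n) = f a.
Proof.
move=> ft; case: n => k; first exact: periodicn.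
by rewrite NegzE mulrNz -[in RHS](subrK (t *+ k.+1) a) periodicn // -pmulrn.
Qed.

Lemma sinD2piz (x : R) n : sin (x + 2 * pi * n%:~R) = sin x.
Proof.
by rewrite -[RHS](periodicz n x (@sinD2pi R)) -[pi *+ 2 *~ n]mulrzr mulr_natl.
Qed.

Lemma cosD2piz (x : R) n : cos (x + 2 * pi * n%:~R) = cos x.
Proof.
by rewrite -[RHS](periodicz n x (@cosD2pi R)) -[pi *+ 2 *~ n]mulrzr mulr_natl.
Qed.

(** * The polar angle and its relation to [theta] *)

Definition norm2 u : R := Num.sqrt (u.1 ^+ 2 + u.2 ^+ 2).

Definition angle u : R :=
  if 0 <= u.2 then acos (u.1 / norm2 u) else - acos (u.1 / norm2 u).

Lemma norm2_sqr u : norm2 u ^+ 2 = u.1 ^+ 2 + u.2 ^+ 2.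
Proof. by rewrite sqr_sqrtr // addr_ge0 ?sqr_ge0. Qed.

Lemma norm2_gt0 u : u != 0 -> 0 < norm2 u.
Proof.
case: u => a b ab; rewrite /norm2 sqrtr_gt0 /= lt0r addr_ge0 ?sqr_ge0 // andbT.
by rewrite paddr_eq0 ?sqr_ge0 // !sqrf_eq0.
Qed.

Lemma norm2N u : norm2 (- u) = norm2 u.
Proof. by rewrite /norm2 /= !sqrrN. Qed.

Lemma cos_sin_bound u : u != 0 -> (u.1 / norm2 u) ^+ 2 + (u.2 / norm2 u) ^+ 2 = 1.
Proof.
move=> /norm2_gt0 r0; rewrite !expr_div_n -mulrDl -norm2_sqr divff //.
by rewrite expf_neq0 // gt_eqF.
Qed.

Lemma cos_bound u : u != 0 -> -1 <= u.1 / norm2 u <= 1.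
Proof. by move=> /cos_sin_bound; nra. Qed.

Lemma cos_angle u : u != 0 -> cos (angle u) = u.1 / norm2 u.
Proof.
move=> /cos_bound cb; rewrite /angle; case: ifP => _; rewrite ?cosN acosK //;
  by rewrite in_itv /= cb.
Qed.

Lemma sin_angle u : u != 0 -> sin (angle u) = u.2 / norm2 u.
Proof.
move=> u0; have cb := cos_bound u0; have r0 := norm2_gt0 u0.
have E : sin (acos (u.1 / norm2 u)) = `|u.2 / norm2 u|.
  rewrite sin_acos // -sqrtr_sqr; congr Num.sqrt.
  by rewrite -(cos_sin_bound u0) addrC addKr.
rewrite /angle; case: ifPn => u2; rewrite ?sinN E.
  by rewrite ger0_norm // divr_ge0 // ltW.
rewrite ltr0_norm ?opprK // pmulr_llt0 ?invr_gt0 //; lra.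
Qed.

Lemma polar1 u : u != 0 -> u.1 = norm2 u * cos (angle u).
Proof. by move=> u0; rewrite cos_angle // mulrC divfK // gt_eqF // norm2_gt0. Qed.

Lemma polar2 u : u != 0 -> u.2 = norm2 u * sin (angle u).
Proof. by move=> u0; rewrite sin_angle // mulrC divfK // gt_eqF // norm2_gt0. Qed.

Lemma angle_range u : u != 0 -> - pi <= angle u <= pi.
Proof.
move=> /cos_bound cb; have := acos_ge0 cb; have := acos_lepi cb.
by have := pi_gt0 R; rewrite /angle; case: ifP => _; lra.
Qed.

Lemma angleN u : u != 0 -> angle (- u) = angle u + pi \/ angle (- u) = angle u - pi.
Proof.
case: u => a b u0; have cb := cos_bound u0; rewrite /angle norm2N /= mulNr acosN //.
rewrite oppr_ge0; case: (ltrgtP b 0) => b0.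
- by left; lra.
- by right; lra.
have a0 : a != 0 by apply: contraNneq u0 => ->; rewrite b0.
have -> : norm2 (a, b) = `|a| by rewrite /norm2 /= b0 expr0n /= addr0 sqrtr_sqr.
case: (ltrgtP a 0) a0 => // a0 _.
- by right; rewrite ltr0_norm // invrN mulrN divff ?acosN1 ?lt_eqF //; lra.
- by left; rewrite gtr0_norm // divff ?acos1 ?gt_eqF //; lra.
Qed.

Lemma norm2_dist (x y : R * R) : dist x y = norm2 (x - y).
Proof. by []. Qed.

Definition cosine u w : R := (u.1 * w.1 + u.2 * w.2) / (norm2 u * norm2 w).

Lemma cosine_angle u w : u != 0 -> w != 0 -> cosine u w = cos (angle u - angle w).
Proof.
move=> u0 w0; rewrite cosB !cos_angle // !sin_angle // /cosine.
have ru := norm2_gt0 u0; have rw := norm2_gt0 w0.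
by field; rewrite !gt_eqF.
Qed.

Lemma theta_acos (x y z : R * R) : theta x y z = acos (cosine (x - y) (z - y)) \/
  theta x y z = 2 * pi - acos (cosine (x - y) (z - y)).
Proof.
rewrite /theta !norm2_dist -/(cosine (x - y) (z - y)).
by case: ifP => _; [left | right].
Qed.

Lemma theta_range (x y z : R * R) : x != y -> z != y -> 0 <= theta x y z <= 2 * pi.
Proof.
rewrite -[x == y]subr_eq0 -[z == y]subr_eq0 => u0 w0.
have cb : -1 <= cosine (x - y) (z - y) <= 1.
  by rewrite cosine_angle // cos_geN1 cos_le1.
have := acos_ge0 cb; have := acos_lepi cb; have := pi_gt0 R.
by case: (theta_acos x y z) => ->; lra.
Qed.

Lemma cos_theta (x y z : R * R) : x != y -> z != y ->
  cos (theta x y z) = cosine (x - y) (z - y).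
Proof.
rewrite -[x == y]subr_eq0 -[z == y]subr_eq0 => u0 w0.
have cb : -1 <= cosine (x - y) (z - y) <= 1.
  by rewrite cosine_angle // cos_geN1 cos_le1.
have E : cos (acos (cosine (x - y) (z - y))) = cosine (x - y) (z - y).
  by rewrite acosK // in_itv /= cb.
case: (theta_acos x y z) => -> //.
rewrite addrC (_ : 2 * pi = 2 * pi * 1%:~R); last by rewrite mulr1.
by rewrite cosD2piz cosN.
Qed.

(** Sign and full turns are left open: bands around the multiples of [pi / 2] do not see them. *)
Lemma theta_angle (x y z : R * R) : x != y -> z != y ->
  exists n, angle (x - y) - angle (z - y) = theta x y z + 2 * pi * n%:~R \/
            angle (x - y) - angle (z - y) = - theta x y z + 2 * pi * n%:~R.
Proof.
rewrite -[x == y]subr_eq0 -[z == y]subr_eq0 => u0 w0.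
have := angle_range u0; have := angle_range w0; have := pi_gt0 R.
have := theta_acos x y z; rewrite cosine_angle //.
set th := theta x y z; set a := angle (x - y); set b := angle (z - y).
move=> tE p0 bR aR.
have : exists n, a - b = acos (cos (a - b)) + 2 * pi * n%:~R \/
            a - b = - acos (cos (a - b)) + 2 * pi * n%:~R.
  case: (leP 0 (a - b)) => ab; case: (leP `|a - b| pi);
    rewrite ?(ger0_norm ab) ?(ltr0_norm ab) => abp.
  - exists 0; left; rewrite cosK ?in_itv /= ?ab ?abp //; lra.
  - exists 1; right; rewrite -(cosN (a - b)) -[cos (- _)](cosD2piz _ 1) cosK ?in_itv /=; lra.
  - exists 0; right; rewrite -(cosN (a - b)) cosK ?in_itv /=; lra.
  - exists (- 1); left; rewrite -[cos _](cosD2piz _ 1) cosK ?in_itv /= ?intrN; lra.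
case=> n; case: tE => ->; case=> E.
- by exists n; left.
- by exists n; right.
- exists (n + 1); right; rewrite intrD; lra.
- exists (n - 1); left; rewrite intrD intrN; lra.
Qed.

(** * Sectors of width [pi / 8] *)

Definition sector s u : int := Num.floor (8 * angle u / pi - s).

(** A full turn is 16 sectors, so this index is independent of the branch of [angle]. *)
Definition osec s u : nat := `|(sector s u %% 16)%Z|%N.

Lemma osec_lt s u : (osec s u < 16)%N.
Proof. by rewrite /osec; lia. Qed.

Lemma sector_bound s u : (sector s u)%:~R <= 8 * angle u / pi - s < (sector s u)%:~R + 1.
Proof. by rewrite -(intrD _ _ 1) floor_itv. Qed.

Lemma floor_uniq (x : R) n : n%:~R <= x < n%:~R + 1 -> Num.floor x = n.
Proof. by move=> H; apply: floor_def; rewrite intrD. Qed.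

Lemma sectorN s u : u != 0 -> sector s (- u) = sector s u + 8 \/ sector s (- u) = sector s u - 8.
Proof.
move=> u0; have := sector_bound s u.
have p0 : pi != 0 :> R by rewrite gt_eqF // pi_gt0.
have H (a : R) : 8 * (a + pi) / pi = 8 * a / pi + 8 by rewrite mulrDr mulrDl mulfK.
have H' (a : R) : 8 * (a - pi) / pi = 8 * a / pi - 8 by rewrite mulrBr mulrBl mulfK.
have F n : n%:~R <= 8 * angle (- u) / pi - s < n%:~R + 1 -> sector s (- u) = n.
  exact: floor_uniq.
move=> sb; case: (angleN u0) => E; [left | right]; apply: F;
  rewrite E ?H ?H' intrD ?intrN; lra.
Qed.

Lemma osecN s u : u != 0 -> osec s (- u) = ((osec s u + 8) %% 16)%N.
Proof. by move=> /(sectorN s); rewrite /osec; lia. Qed.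

Lemma floor_close (x y : R) n : `|x - y - n%:~R| < 1 -> `|Num.floor x - Num.floor y - n| <= 1.
Proof.
move=> H; have := floor_itv x; have := floor_itv y; move: H.
rewrite ltr_norml !intrD => /andP[H1 H2] /andP[y1 y2] /andP[x1 x2].
have U : Num.floor x - Num.floor y - n < 2.
  by rewrite -(ltr_int R) !intrD !intrN; lra.
have L : - 2 < Num.floor x - Num.floor y - n.
  by rewrite -(ltr_int R) !intrD !intrN; lra.
by lia.
Qed.

(* Bands of half-width [e < pi / 8] around the multiples of [pi / 2]: in units
   of [pi / 8] a direction is displaced by less than one. *)
Lemma band_sector (e s : R) (x y z : R * R) (k : nat) : e < pi / 8 -> x != y -> z != y ->
  in_band e (k%:R * pi / 2) (theta x y z) ->
  exists n, `|sector s (x - y) - sector s (z - y) - (4 * k%:Z + 16 * n)| <= 1 \/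
            `|sector s (x - y) - sector s (z - y) - (- 4 * k%:Z + 16 * n)| <= 1.
Proof.
move=> e8 xy zy [t1 t2]; have p0 := pi_gt0 R.
have H (a b : R) (m : int) : `|a - b - m%:~R * pi / 2| < pi / 8 ->
    `|Num.floor (8 * a / pi - s) - Num.floor (8 * b / pi - s) - 4 * m| <= 1.
  move=> lt; apply: floor_close.
  have -> : (8 * a / pi - s) - (8 * b / pi - s) - (4 * m)%:~R = (a - b - m%:~R * pi / 2) * (8 / pi).
    by rewrite intrM; move: (pi) p0 => p p0; field; rewrite gt_eqF.
  rewrite normrM (ger0_norm (_ : 0 <= 8 / pi)) ?divr_ge0 ?pi_ge0 //.
  by rewrite -ltr_pdivlMr ?divr_gt0 // div1r invf_div.
have [n E] := theta_angle xy zy; exists n; rewrite /sector.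
case: E => E; [left | right].
- have -> : 4 * k%:Z + 16 * n = 4 * (k%:Z + 4 * n) by lia.
  apply: H; rewrite E intrD intrM -pmulrn ltr_norml; apply/andP; split; lra.
- have -> : - 4 * k%:Z + 16 * n = 4 * (- k%:Z + 4 * n) by lia.
  apply: H; rewrite E intrD intrM intrN -pmulrn ltr_norml; apply/andP; split; lra.
Qed.

(** Turning one bond by an odd multiple of [pi] makes a nearly straight pair nearly parallel; the
    bend becomes a distance of reals, as [floor_shift] requires. *)
Lemma straight_angle (x y z : R * R) : x != y -> z != y ->
  exists n, `|angle (x - y) - (angle (z - y) + (2 * n + 1)%:~R * pi)| = `|theta x y z - pi|.
Proof.
move=> xy zy; have [n [E|E]] := theta_angle xy zy.
- exists n; congr `|_|; rewrite intrD intrM -[X in X = _]/(_ - _); lra.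
- exists (n - 1); rewrite -normrN; congr `|_|; rewrite !intrD !intrM intrD intrN; lra.
Qed.

(** Cross product of the unit vector at angle [a] with [u]: linear in [u], its sign tells the
    half-plane. *)
Definition side (a : R) u : R := cos a * u.2 - sin a * u.1.

Lemma sideE a u : u != 0 -> side a u = norm2 u * sin (angle u - a).
Proof. by move=> u0; rewrite /side {1}(polar1 u0) {1}(polar2 u0) sinB; ring. Qed.

Lemma sideD a u w : side a (u + w) = side a u + side a w.
Proof. by rewrite /side /=; ring. Qed.

(** A sector is the intersection of a closed and an open half-plane: the two signs single out offset
    0 among the 16. *)
Lemma sin_period (j : nat) (t : R) : 0 <= t < pi / 8 -> (j < 16)%N ->
  0 <= sin (j%:R * pi / 8 + t) -> sin (j%:R * pi / 8 + t - pi / 8) < 0 -> j = 0%N.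
Proof.
move=> /andP[t0 t8] j16 s1 s2; have p0 := pi_gt0 R.
case: (posnP j) => // j0; exfalso.
have j1 : 1 <= j%:R :> R by rewrite ler1n.
have j15 : j%:R <= 15 :> R by rewrite ler_nat.
have j78 : j%:R <= 7 :> R \/ 8 <= j%:R :> R.
  by case: (leqP j 7) => ?; [left | right]; rewrite ler_nat.
move: j1 j15 j78 s1 s2; move: (j%:R) => J {j j0 j16} J1 J15 [J7|J8] s1 s2.
  have : 0 <= sin (J * pi / 8 + t - pi / 8) by apply: sin_ge0_pi; nra.
  by lra.
have spi (x : R) : sin (x - pi) = - sin x by rewrite sinB sinpi cospi; ring.
case: (eqVneq (J * pi / 8 + t) pi) => E.
  have : 0 < sin (pi / 8 : R) by apply: sin_gt0_pi; lra.
  have E8 : sin (pi - pi / 8) = sin (pi / 8) :> R.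
    by rewrite sinB sinpi cospi; ring.
  by rewrite E E8 in s2; lra.
have E' : pi < J * pi / 8 + t by rewrite lt_neqAle eq_sym E; nra.
have : 0 < sin (J * pi / 8 + t - pi) by apply: sin_gt0_pi; nra.
by rewrite spi; lra.
Qed.

Lemma sector_side s u (k : nat) : u != 0 -> exists j t,
  [/\ 0 <= t < pi / 8, (j < 16)%N, (osec s u = (k + j) %% 16)%N,
      side ((k%:R + s) * pi / 8) u = norm2 u * sin (j%:R * pi / 8 + t) &
      side ((k%:R + s) * pi / 8 + pi / 8) u = norm2 u * sin (j%:R * pi / 8 + t - pi / 8)].
Proof.
move=> u0; have p0 := pi_gt0 R; have /andP[b1 b2] := sector_bound s u.
pose j : nat := `|((sector s u - k%:Z) %% 16)%Z|%N.
pose t := angle u - ((sector s u)%:~R + s) * pi / 8.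
have [n En] : exists n, sector s u = k%:Z + j%:Z + 16 * n.
  by exists ((sector s u - k%:Z) %/ 16)%Z; rewrite /j; lia.
have tE : t = (8 * angle u / pi - s - (sector s u)%:~R) * (pi / 8).
  by rewrite /t; move: (pi) p0 => p p0; field; rewrite gt_eqF.
have aE : angle u - (k%:R + s) * pi / 8 = j%:R * pi / 8 + t + 2 * pi * n%:~R.
  rewrite /t En !intrD intrM -!pmulrn; lra.
exists j, t; split.
- rewrite tE; apply/andP; split; first by apply: mulr_ge0; lra.
  by rewrite -[ltRHS]mul1r ltr_pM2r; lra.
- by rewrite /j; lia.
- by rewrite /osec En; lia.
- by rewrite sideE // aE sinD2piz.
- rewrite sideE // opprD addrA aE addrAC sinD2piz; congr (_ * sin _).
Qed.

(** Both half-planes bounding a sector are closed under addition; the strict one excludes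
    [u + w = 0]. *)
Lemma osec_cone s u w : u != 0 -> w != 0 -> osec s u = osec s w ->
  u + w != 0 /\ osec s (u + w) = osec s u.
Proof.
move=> u0 w0 E; have p0 := pi_gt0 R.
pose k := osec s u.
have k16 : (k < 16)%N := osec_lt s u.
have side_in v : v != 0 -> osec s v = k ->
    0 <= side ((k%:R + s) * pi / 8) v /\ side ((k%:R + s) * pi / 8 + pi / 8) v < 0.
  move=> v0 vk; have [j [t [t8 j16 Ej -> ->]]] := sector_side s k v0.
  have -> : j = 0%N by lia.
  have r0 := norm2_gt0 v0; rewrite !mul0r add0r; split.
    by rewrite mulr_ge0 ?(ltW r0) // sin_ge0_pi //; lra.
  rewrite pmulr_rlt0 // -oppr_gt0 -sinN sin_gt0_pi //; lra.
have [u1 u2] := side_in u u0 erefl; have [w1 w2] := side_in w w0 (esym E).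
have uw1 : 0 <= side ((k%:R + s) * pi / 8) (u + w) by rewrite sideD addr_ge0.
have uw2 : side ((k%:R + s) * pi / 8 + pi / 8) (u + w) < 0 by rewrite sideD; lra.
have uw0 : u + w != 0.
  by apply: contraTneq uw2 => ->; rewrite /side !mulr0 subrr ltxx.
split=> //; have [j [t [t8 j16 Ej E1 E2]]] := sector_side s k uw0.
have r0 := norm2_gt0 uw0.
move: uw1 uw2; rewrite E1 E2 pmulr_rge0 // pmulr_rlt0 // => s1 s2.
by rewrite Ej (sin_period t8 j16 s1 s2) addn0 modn_small.
Qed.

End Directions.

(** * Angles in the lattice *)

Section LatticeAngles.
Variable R : realType.
Local Open Scope ring_scope.

Lemma int_sqrD_lt2 (a b : int) : 0 < a ^+ 2 + b ^+ 2 < 2 ->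
  [\/ a = 1 /\ b = 0, a = -1 /\ b = 0, a = 0 /\ b = 1 | a = 0 /\ b = -1].
Proof.
move=> H; have a1 : -1 <= a <= 1 by rewrite !expr2 in H; clear -H; apply/andP; split; nia.
have b1 : -1 <= b <= 1 by rewrite !expr2 in H; clear -H; apply/andP; split; nia.
have [Ea|[Ea|Ea]] : a = -1 \/ a = 0 \/ a = 1 by clear -a1; lia.
all: have [Eb|[Eb|Eb]] : b = -1 \/ b = 0 \/ b = 1 by clear -b1; lia.
all: subst a b; try by []; by [constructor 1 | constructor 2 | constructor 3 | constructor 4].
Qed.

Lemma lattice_unit (x y : R * R) : Lminus x -> Lminus y -> x != y -> dist x y < Num.sqrt 2 ->
  exists a b : int, x - y = (a%:~R, b%:~R) /\
    [\/ a = 1 /\ b = 0, a = -1 /\ b = 0, a = 0 /\ b = 1 | a = 0 /\ b = -1].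
Proof.
move=> [a [b [-> _]]] [c [d [-> _]]] xy; rewrite /dist /= ltr_sqrt ?ltr0n // => lt2.
exists (a - c), (b - d); rewrite !intrB; split=> //; apply: int_sqrD_lt2.
rewrite -(ltr_int R) -(ltr_int R _ 2) rmorphD !rmorphXn !rmorphB /= lt2 andbT.
rewrite lt_neqAle addr_ge0 ?sqr_ge0 // andbT eq_sym paddr_eq0 ?sqr_ge0 // !sqrf_eq0 !subr_eq0.
by apply: contra xy => /andP[/eqP -> /eqP ->].
Qed.

(** Makes angles within the substrate free of energy, so the infinitely many substrate triples
    contribute nothing. *)
Lemma lattice_right (x y z : R * R) : Lminus x -> Lminus y -> Lminus z ->
  x != y -> z != y -> x != z -> dist x y < Num.sqrt 2 -> dist z y < Num.sqrt 2 ->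
  theta x y z = pi / 2 \/ theta x y z = pi \/ theta x y z = 3 * pi / 2.
Proof.
move=> Lx Ly Lz xy zy xz dx dz.
have [a [b [Eu U]]] := lattice_unit Lx Ly xy dx.
have [c [d [Ew W]]] := lattice_unit Lz Ly zy dz.
have uw : x - y != z - y by rewrite (inj_eq (addIr _)).
have : cosine (x - y) (z - y) = 0 \/ cosine (x - y) (z - y) = -1.
  rewrite Eu Ew in uw *; rewrite /cosine /norm2 /=.
  by case: U uw => -[-> ->]; case: W => -[-> ->]; rewrite ?eqxx // => _;
    rewrite ?mulr0 ?mul0r ?mulr1 ?addr0 ?add0r ?rmorphN1 ?sqrrN ?expr0n ?expr1n ?addr0
      ?add0r ?sqrtr1
      ?mulrN1 ?mulN1r ?opprK ?mulr1 ?divr1; first [by left; lra | by right; lra].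
have p2 : 2 * pi - pi / 2 = 3 * pi / 2 :> R by lra.
have p3 : 2 * pi - pi = pi :> R by lra.
by case: (theta_acos x y z) => ->; case=> ->; rewrite ?acos0 ?acosN1 ?p2 ?p3; auto.
Qed.
End LatticeAngles.

(** * Energy in a finite window *)

Section FiniteEnergy.
Import fintype boot.finset.
Local Open Scope ring_scope.
Variables (R : realType) (beta eps r0 : R) (v v3 : R -> R).
Hypothesis beta_gt0 : 0 < beta.
Hypothesis eps_gt0 : 0 < eps.
Hypothesis eps_lt : eps < 10^-1.
Hypothesis r0_gt1 : 1 < r0.
Hypothesis r0_lt : r0 < Num.sqrt 2.
Hypothesis v_ge : forall r, 0 <= r -> -1 <= v r.
Hypothesis v_min : forall r, 0 <= r -> v r = -1 -> r = 1.
Hypothesis v_far : forall r, r0 <= r -> v r = 0.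
Hypothesis v3_right : cond_ii3 v3.
Hypothesis v3_straight : cond_iii3 eps v3.
Hypothesis v3_off : cond_iv3 eps beta v3.

Variables (T : finType) (pos : T -> R * R) (sub : {set T}).
Hypothesis pos_inj : injective pos.
Hypothesis sub_lattice : forall z, z \in sub -> Lminus (pos z).
Hypothesis above : forall p, p \notin sub -> 0 < (pos p).2.

Definition near : rel T := [rel x y | (x != y) && (dist (pos x) (pos y) < r0)].

Hypothesis sub_window : forall p z e, p \notin sub -> z \in sub -> near p z ->
  norm2 e = 1 -> Lminus (pos z + e) -> exists2 z', z' \in sub & pos z' = pos z + e.

Definition tri (A : {set T}) (t : T * T * T) : bool :=
  [&& t.1.1 \in A :|: sub, t.1.2 \in A :|: sub, t.2 \in A :|: sub,
      t.1.1 != t.2, near t.1.1 t.1.2 & near t.1.2 t.2].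

Definition ang3 (t : T * T * T) : R := theta (pos t.1.1) (pos t.1.2) (pos t.2).

Definition pair_energy (A : {set T}) : R :=
  \sum_(x in A) \sum_(y in A | y != x) v (dist (pos x) (pos y)).
Definition sub_energy (A : {set T}) : R :=
  \sum_(x in A) \sum_(z in sub) v (dist (pos x) (pos z)).
Definition angle_energy (A : {set T}) : R := \sum_(t | tri A t) v3 (ang3 t).

Definition fenergy (A : {set T}) : R :=
  2^-1 * pair_energy A + beta * sub_energy A + 2^-1 * angle_energy A.

Definition inband (k : nat) (t : R) : bool := `|t - k%:R * pi / 2| <= eps.
Definition good (t : R) : bool := [|| inband 1 t, inband 2 t | inband 3 t].

Lemma dist_ge0 (x y : R * R) : 0 <= dist x y.
Proof. exact: sqrtr_ge0. Qed.

Lemma distC (x y : R * R) : dist x y = dist y x.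
Proof. by rewrite !norm2_dist -opprB norm2N. Qed.

Lemma near_sym : symmetric near.
Proof. by move=> x y; rewrite /near /= eq_sym distC. Qed.

Lemma near_irr : irreflexive near.
Proof. by move=> x; rewrite /near /= eqxx. Qed.

Lemma pos_neq x y : x != y -> pos x != pos y.
Proof. by apply: contra => /eqP /pos_inj ->. Qed.

Lemma pos_sub_neq x y : x != y -> pos x - pos y != 0.
Proof. by rewrite subr_eq0; exact: pos_neq. Qed.

Lemma near_pos x y : near x y -> pos x != pos y.
Proof. by case/andP=> xy _; exact: pos_neq. Qed.

Lemma inband_in k t : inband k t -> in_band eps (k%:R * pi / 2) t.
Proof. by rewrite /inband ler_distl => /andP[]. Qed.

Lemma ang3_range A t : tri A t -> 0 <= ang3 t <= 2 * pi.
Proof.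
case/and5P=> _ _ _ _ /andP[n1 n2]; apply: theta_range; first exact: near_pos.
by apply: near_pos; rewrite near_sym.
Qed.

Lemma v3_ge0 t : 0 <= t <= 2 * pi -> 0 <= v3 t.
Proof.
case/andP=> t0 t2; have [h1 [h2 [h3 h4]]] := v3_right.
case: (eqVneq t (pi / 2)) => [->|n1]; first by rewrite h1.
case: (eqVneq t pi) => [->|n2]; first by rewrite h2.
case: (eqVneq t (3 * pi / 2)) => [->|n3]; first by rewrite h3.
by apply/ltW/h4.
Qed.

Lemma v3_tri_ge0 A t : tri A t -> 0 <= v3 (ang3 t).
Proof. by move=> /ang3_range /v3_ge0. Qed.

(** (iv_3) gives at least [4 * (36 / 10)] times the maximum; half of 14 is what [removal] can spend
    per bad triple. *)
Lemma v3_bad t : 0 <= t <= 2 * pi -> ~~ good t -> 14 * Num.max 1 beta <= v3 t.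
Proof.
case/andP=> t0 t2; rewrite !negb_or => /and3P[b1 b2 b3].
have nb k x : x = k%:R * pi / 2 -> ~~ inband k t -> ~ in_band eps x t.
  by move=> -> /negP nb [h1 h2]; apply: nb; rewrite /inband ler_distl h1 h2.
have el := eps_lt; have eg := eps_gt0; have := v3_off t0 t2.
move=> /(_ (nb 1%N _ _ b1) (nb 2%N _ _ b2) (nb 3%N _ _ b3)).
rewrite mul1r => /(_ erefl); rewrite mulrAC divff // mul1r => /(_ erefl erefl) /ltW.
apply: le_trans.
have s2 : 14 / 10 <= Num.sqrt 2 :> R.
  rewrite -[14 / 10]ger0_norm ?divr_ge0 // -sqrtr_sqr ler_wsqrtr // expr2; lra.
have m1 : Num.max 1 beta <= Num.max 1 (2 * beta).
  have bb : beta <= 2 * beta by move: beta_gt0; lra.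
  by rewrite ge_max !le_max lexx bb orbT.
have m0 : 1 <= Num.max 1 beta by rewrite le_max lexx.
have e2 : 0 < (1 - eps) ^+ 2 <= 1.
  rewrite exprn_gt0 /=; last by lra.
  by rewrite expr_le1 //; lra.
have e4 : 4 <= 4 / (1 - eps) ^+ 2.
  by rewrite ler_pdivlMr; nra.
have q : 36 / 10 <= (Num.sqrt 2 + 2^-1) ^+ 2 :> R by nra.
apply: (@le_trans _ _ (Num.max 1 (2 * beta) * (4 * (36 / 10)))); first by nra.
rewrite -mulrA ler_pM2l; last by lra.
by apply: ler_pM; lra.
Qed.

(** The slope in (iii_3) is at least [40 / pi]: measured in units of [pi / 8], bending costs 5 per
    unit. *)
Lemma v3_bend t : inband 2 t -> 5 * (8 / pi * `|t - pi|) <= v3 t.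
Proof.
rewrite /inband mulrAC divff // mul1r ler_distl => /andP[h1 h2].
have [+ _] := v3_straight h1 h2; apply: le_trans.
have p0 := pi_ge2 R; have el := eps_lt; have eg := eps_gt0.
rewrite !mulrA ler_wpM2r //.
rewrite ler_pdivrMr; last by lra.
rewrite mulrAC ler_pdivlMr; lra.
Qed.

Lemma right_of_good s x y z : pos x != pos y -> pos z != pos y ->
  good (theta (pos x) (pos y) (pos z)) ->
  right_diff (osec s (pos x - pos y)) (osec s (pos z - pos y)).
Proof.
move=> xy zy g.
have e8 : eps < pi / 8 by move: (pi_ge2 R) eps_lt; lra.
have [k k13 /inband_in b] :
    exists2 k : nat, (0 < k < 4)%N & inband k (theta (pos x) (pos y) (pos z)).
  by case/or3P: g => b; [exists 1%N | exists 2%N | exists 3%N].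
have [n H] := band_sector s e8 xy zy b.
move: H; rewrite /right_diff /absdiff /osec.
set a := sector _ _; set c := sector _ _ => H.
have [E|[E|E]] : k = 1%N \/ k = 2%N \/ k = 3%N by clear -k13; lia.
all: by rewrite E in H; case: H => H; clear -H; lia.
Qed.

Lemma card_right_clique (X : {set T}) (f : T -> nat) : (forall x, f x < 16)%N ->
  {in X &, forall x y, x != y -> right_diff (f x) (f y)} -> (#|X| <= 4)%N.
Proof.
move=> f16 Xr; case: (set_0Vmem X) => [->|[y0 y0X]]; first by rewrite cards0.
(* [17] is [16 + 1]: after adding one, offsets within one of 0, 4, 8, 12 fall into distinct blocks
   of length 4, and two directions in one block are too close. *)
pose g x : 'I_4 := inord (((f x + 17 - f y0) %% 16) %/ 4).
have gv x : g x = (((f x + 17 - f y0) %% 16) %/ 4)%N :> nat by rewrite inordK //; lia.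
have g_inj : {in X &, injective g}.
  move=> x y xX yX /(congr1 val); rewrite /= !gv => E.
  apply/eqP/contraT => xy.
  have := Xr x y xX yX xy.
  have D z : z \in X -> f z = f y0 \/ right_diff (f z) (f y0).
    by move=> zX; case: (eqVneq z y0) => [->|zy]; [left | right; exact: Xr].
  move: (D x xX) (D y yX) (f16 x) (f16 y) (f16 y0) E; rewrite /right_diff /absdiff.
  by move: (f x) (f y) (f y0); clear; lia.
by rewrite -(card_in_imset g_inj) -[leqRHS](card_ord 4) max_card.
Qed.

(** * Removing a particle with a bad angle *)

Definition nbrs (A : {set T}) := nbr A sub near.

Definition bad (A : {set T}) (p : T) : {set T * T * T} :=
  [set t | [&& tri A t, ~~ tri (A :\ p) t & ~~ good (ang3 t)]].

Lemma tri_center (A : {set T}) p y w : p \in A -> y \in nbrs A p -> w \in nbrs A p -> y != w ->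
  tri A (y, p, w).
Proof.
move=> pA; rewrite !inE => /andP[yA py] /andP[wA pw] yw.
by rewrite /tri /= !inE pA yA wA yw near_sym py pw.
Qed.

Lemma tri_removed (A : {set T}) p t : p \notin sub -> (p == t.1.1) || (p == t.1.2) || (p == t.2) ->
  ~~ tri (A :\ p) t.
Proof.
move=> ps H; rewrite /tri !inE.
by case/orP: H => [/orP[]|] /eqP <-; rewrite eqxx (negbTE ps) /= ?andbF.
Qed.

(* Four directions at most are pairwise at good angles, and every further
   neighbour is in a bad angle with one of a maximal good family. *)
Lemma card_bad (A : {set T}) p : p \in A -> p \notin sub -> (#|nbrs A p| - 4 <= #|bad A p|)%N.
Proof.
(* Both orders of the pair are tested, which makes [gd] symmetric by construction. *)
move=> pA ps; pose gd y w := good (ang3 (y, p, w)) && good (ang3 (w, p, y)).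
pose clique (G : {set T}) := (G \subset nbrs A p) &&
  [forall y in G, forall w in G, (y != w) ==> gd y w].
have c0 : clique set0.
  by rewrite /clique sub0set; apply/forall_inP => y; rewrite inE.
case: (@arg_maxnP _ set0 clique (fun G => #|G|) c0) => G /andP[GN /forall_inP Gg] Gmax.
have G4 : (#|G| <= 4)%N.
  apply: (@card_right_clique _ (fun y => osec 0 (pos y - pos p))) => [x|x y xG yG xy].
    exact: osec_lt.
  have /forall_inP/(_ _ yG)/implyP/(_ xy)/andP[g1 _] := Gg x xG.
  have px : near p x by have := subsetP GN _ xG; rewrite inE => /andP[].
  have py : near p y by have := subsetP GN _ yG; rewrite inE => /andP[].
  by apply: right_of_good => //; apply: near_pos; rewrite near_sym.
have badG y : y \in nbrs A p :\: G -> exists2 g, (g \in G) && (y != g) & ~~ gd y g.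
  rewrite inE => /andP[yG yN]; apply/exists_inP/contraT => /exists_inPn no.
  suff /Gmax /= : clique (y |: G) by rewrite cardsU1 yG /= add1n ltnn.
  rewrite /clique subUset sub1set yN GN /=.
  have gdC a b : gd a b = gd b a by rewrite /gd andbC.
  have gdy g : g \in G -> y != g -> gd y g.
    by move=> gG yg; move: (no g); rewrite unfold_in /= gG yg negbK => /(_ isT).
  apply/forall_inP => a /setU1P[->|aG]; apply/forall_inP => b /setU1P[->|bG]; apply/implyP => ab.
  - by rewrite eqxx in ab.
  - exact: gdy.
  - by rewrite gdC gdy // eq_sym.
  - by have /forall_inP/(_ _ bG)/implyP/(_ ab) := Gg a aG.
pose wit y := odflt y [pick g | (g \in G) && (y != g) && ~~ gd y g].
have witP y : y \in nbrs A p :\: G -> [/\ wit y \in G, y != wit y & ~~ gd y (wit y)].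
  move=> /badG[g gG ng]; rewrite /wit; case: pickP => [h /andP[/andP[]]|/(_ g)] //.
  by rewrite gG ng.
(* The pair is listed in an order whose angle is bad; its end outside [G] recovers [y]. *)
pose f y := if good (ang3 (y, p, wit y)) then (wit y, p, y) else (y, p, wit y).
have f_inj : {in nbrs A p :\: G &, injective f}.
  move=> x y xN yN; have [wx _ _] := witP x xN; have [wy _ _] := witP y yN.
  have xG : x \notin G by move: xN; rewrite inE => /andP[].
  have yG : y \notin G by move: yN; rewrite inE => /andP[].
  rewrite /f; case: ifP => _; case: ifP => _ [E1 E2] //.
    by rewrite -E1 wx in yG.
  by rewrite E1 wy in xG.
have : (#|nbrs A p :\: G| <= #|bad A p|)%N.
  rewrite -(card_in_imset f_inj); apply: subset_leq_card.
  apply/subsetP => _ /imsetP[y yN ->]; have [wG yw ng] := witP y yN.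
  have yN' : y \in nbrs A p by move: yN; rewrite inE => /andP[].
  have wN := subsetP GN _ wG.
  rewrite /f /bad inE; move: ng; rewrite /gd; case: ifP => /= g1 ng.
    by rewrite ng tri_center 1?eq_sym //= tri_removed //= eqxx orbT.
  by rewrite g1 tri_center //= tri_removed //= eqxx orbT.
apply: leq_trans; rewrite cardsD leq_sub2l //.
exact: leq_trans (subset_leq_card (subsetIr _ _)) G4.
Qed.

Lemma v_near x y : - (near x y)%:R <= v (dist (pos x) (pos y)) \/ x = y.
Proof.
case: (eqVneq x y) => xy; [by right | left].
rewrite /near /= xy /=; case: ltP => d; first exact/v_ge/dist_ge0.
by rewrite v_far // oppr0.
Qed.

Lemma v_near_sum p (B : {set T}) : p \notin B ->
  - (#|[set y in B | near p y]|%:R) <= \sum_(y in B) v (dist (pos p) (pos y)).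
Proof.
move=> pB; rewrite -sum1_card natr_sum -sumrN big_mkcond [leRHS]big_mkcond /=.
apply: ler_sum => y _; rewrite inE; case: (boolP (y \in B)) => //= yB.
case: (v_near p y) => [|E]; first by case: near; rewrite ?oppr0.
by rewrite E yB in pB.
Qed.

Lemma pair_energyD1 (A : {set T}) p : p \in A ->
  pair_energy A = pair_energy (A :\ p) + 2 * \sum_(y in A :\ p) v (dist (pos p) (pos y)).
Proof.
move=> pA; rewrite /pair_energy (big_setD1 p) //=.
have -> : \sum_(y in A | y != p) v (dist (pos p) (pos y)) =
    \sum_(y in A :\ p) v (dist (pos p) (pos y)).
  by apply: eq_bigl => y; rewrite !inE andbC.
have -> : \sum_(x in A :\ p) \sum_(y in A | y != x) v (dist (pos x) (pos y)) =
    \sum_(x in A :\ p) (v (dist (pos p) (pos x)) +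
      \sum_(y in A :\ p | y != x) v (dist (pos x) (pos y))).
  apply: eq_bigr => x /setD1P[xp xA]; rewrite (bigD1 p) /=; last by rewrite pA eq_sym.
  rewrite distC; congr (_ + _); apply: eq_bigl => y; rewrite !inE -!andbA.
  by rewrite [in RHS]andbC -!andbA.
by rewrite big_split /=; ring.
Qed.

(** With [mx] the maximum of 1 and [beta], deleting [p] gives up at most [mx] per bond and saves at
    least [7 * mx] per bad triple. *)
Lemma removal (A : {set T}) t p : (forall q, q \in A -> q \notin sub) ->
  tri A t -> ~~ good (ang3 t) -> p \in A ->
  (p == t.1.1) || (p == t.1.2) || (p == t.2) -> fenergy (A :\ p) <= fenergy A.
Proof.
move=> A_sub tA tbad pA pt; have ps := A_sub p pA.
have b1 : (0 < #|bad A p|)%N.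
  by apply/card_gt0P; exists t; rewrite inE tA tbad tri_removed.
have bM := card_bad pA ps.
set M := #|nbrs A p| in bM; set b := #|bad A p| in b1 bM.
pose n1 := #|[set y in A :\ p | near p y]|; pose n2 := #|[set z in sub | near p z]|.
have nM : (n1 + n2 <= M)%N.
  have dj : [set y in A :\ p | near p y] :&: [set z in sub | near p z] = set0.
    apply/setP => y; rewrite !inE; apply/negP => /andP[/andP[/andP[_ yA] _] /andP[ys _]].
    by move: (A_sub y yA); rewrite ys.
  have <- : #|[set y in A :\ p | near p y] :|: [set z in sub | near p z]| = (n1 + n2)%N.
    by rewrite cardsU dj cards0 subn0.
  apply: subset_leq_card; apply/subsetP => y; rewrite !inE.
  by case/orP=> [/andP[/andP[_ ->] ->]|/andP[-> ->]]; rewrite ?orbT.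
have e1 : - n1%:R <= \sum_(y in A :\ p) v (dist (pos p) (pos y)).
  by apply: v_near_sum; rewrite !inE eqxx.
have e2 : - n2%:R <= \sum_(z in sub) v (dist (pos p) (pos z)) by exact: v_near_sum.
pose mx := Num.max 1 beta.
have mx1 : 1 <= mx by rewrite le_max lexx.
have mxb : beta <= mx by rewrite le_max lexx orbT.
have e3 : angle_energy (A :\ p) + 14 * mx * b%:R <= angle_energy A.
  rewrite /angle_energy [leRHS](bigID (tri (A :\ p))) /=.
  have -> : \sum_(i | tri A i && tri (A :\ p) i) v3 (ang3 i) =
      \sum_(i | tri (A :\ p) i) v3 (ang3 i).
    apply: eq_bigl => -[[x y] z]; apply: andb_idl; rewrite /tri /= !inE.
    by case/and5P=> /orP[/andP[_ ->]|->] /orP[/andP[_ ->]|->] /orP[/andP[_ ->]|->] -> ->;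
      rewrite ?orbT.
  rewrite lerD2l [leRHS](bigID (fun t => good (ang3 t))) /= -[leLHS]add0r; apply: lerD.
    by apply: sumr_ge0 => u /andP[/andP[uA _] _]; exact: (v3_tri_ge0 uA).
  have -> : 14 * mx * b%:R = \sum_(u | tri A u && ~~ tri (A :\ p) u && ~~ good (ang3 u)) 14 * mx.
    rewrite mulr_natr -sumr_const; apply: eq_bigl => u; by rewrite inE andbA.
  by apply: ler_sum => u /andP[/andP[uA _] ub]; apply: v3_bad => //; exact: (ang3_range uA).
rewrite /fenergy (pair_energyD1 pA) /sub_energy (big_setD1 p pA) /=.
(* From [b >= 1] and [M - 4 <= b] one even gets [M <= 5 * b]. *)
have bN' : (n1 + n2 <= 7 * b)%N by move: nM bM b1; clearbody M b n1 n2; clear; lia.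
have bN : (n1 + n2)%:R <= 7 * b%:R :> R by rewrite -[7]/(7%:R) -natrM ler_nat.
clearbody M b n1 n2 mx.
have h0 : 0 <= mx * (7 * b%:R - (n1 + n2)%:R) by apply: mulr_ge0; [lra | rewrite subr_ge0].
have h1 : n1%:R <= mx * n1%:R by rewrite ler_peMl.
have h2 : beta * n2%:R <= mx * n2%:R by rewrite ler_wpM2r.
have h3 := ler_wpM2l (ltW beta_gt0) e2.
rewrite natrD in h0.
move: e1 e3 h0 h1 h2 h3.
set s1 := \sum_(y in A :\ p) _; set s2 := \sum_(z in sub) _.
move: (angle_energy _) (angle_energy _) (pair_energy _) (\sum_(x in A :\ p) _) => a1 a2 pe S'.
lra.
Qed.

(** * Directions of contacts, cuts, and the energy as a count *)

Definition ex : R * R := (1, 0).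
Definition ey : R * R := (0, 1).

Lemma osec_axes s : 0 <= s < 1 ->
  [/\ osec s ex = 0%N \/ osec s ex = 15%N,
      osec s (- ex) = ((osec s ex + 8) %% 16)%N &
      osec s (- ey) = ((osec s ex + 12) %% 16)%N].
Proof.
move=> s01; have p0 := pi_gt0 R.
have a1 : angle ex = 0 :> R.
  by rewrite /ex /ey /angle /norm2 /= lexx expr0n addr0 expr1n sqrtr1 divr1 acos1.
have a2 : angle ey = pi / 2 :> R.
  by rewrite /ex /ey /angle /norm2 /= ler01 mul0r acos0.
have n1 : ex != 0 by rewrite /ex /ey xpair_eqE negb_and oner_eq0.
have n2 : ey != 0 by rewrite /ex /ey xpair_eqE negb_and oner_eq0 orbT.
have S1 : sector s ex = Num.floor (- s) by rewrite /sector a1 mulr0 mul0r add0r.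
have S2 : sector s ey = 4 + Num.floor (- s).
  apply: floor_uniq; rewrite a2 intrD; have := floor_itv (- s); rewrite intrD.
  have -> : 8 * (pi / 2) / pi = 4 :> R by move: (pi : R) p0 => q q0; field; rewrite gt_eqF.
  by move=> ?; lra.
have f01 : - 1 <= Num.floor (- s) <= 0.
  by rewrite floor_ge_int -ltzD1 floor_lt_int; apply/andP; split; rewrite ?intrN ?intrD; lra.
have O1 : osec s ex = `|(Num.floor (- s) %% 16)%Z|%N by rewrite /osec S1.
have O2 : osec s ey = `|((4 + Num.floor (- s)) %% 16)%Z|%N by rewrite /osec S2.
rewrite !osecN // O2 O1; have [->|->] : Num.floor (- s) = -1 \/ Num.floor (- s) = 0.
- by move: f01; move: (Num.floor _); clear; lia.
- by split=> //; right.
- by split=> //; left.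
Qed.

(** Right angles shift the index by 4 or 12 up to one, so 7 and 9 come from straight angles only.
    Equal floors would make the difference an odd multiple of 8. *)
Lemma cut_straight s (x y z : R * R) : x != y -> z != y -> good (theta x y z) ->
  cut_diff (osec s (x - y)) (osec s (z - y)) ->
  inband 2 (theta x y z) /\
  forall n, Num.floor (8 * angle (x - y) / pi - s) !=
            Num.floor (8 * (angle (z - y) + (2 * n + 1)%:~R * pi) / pi - s).
Proof.
move=> xy zy g; have p0 := pi_gt0 R.
rewrite /cut_diff /absdiff /osec => c.
have {c} [q Dq] : exists q, sector s (x - y) - sector s (z - y) = 16 * q + 7 \/
    sector s (x - y) - sector s (z - y) = 16 * q + 9.
  move: c; move: (sector s (x - y)) (sector s (z - y)) => a b c.
  have := divz_eq a 16; have := divz_eq b 16.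
  have := modz_ge0 a (isT : 16 != 0 :> int); have := modz_ge0 b (isT : 16 != 0 :> int).
  have := ltz_pmod a (isT : 0 < 16 :> int); have := ltz_pmod b (isT : 0 < 16 :> int).
  move: c; move: (a %% 16)%Z (b %% 16)%Z (a %/ 16)%Z (b %/ 16)%Z => a' b' ka kb.
  move=> c b16 a16 b0 a0 -> ->.
  clear -c b16 a16 b0 a0; case/orP: c => /eqP c.
    case: (ltP b' a') => ab; [exists (ka - kb); left | exists (ka - kb - 1); right]; lia.
  case: (ltP b' a') => ab; [exists (ka - kb); right | exists (ka - kb - 1); left]; lia.
have e8 : eps < pi / 8 by move: (pi_ge2 R) eps_lt; lra.
split.
  have H k : (k == 1%N) || (k == 3%N) -> ~~ inband k (theta x y z).
    move=> k13; apply/negP => /inband_in b; have [n] := band_sector s e8 xy zy b.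
    move: (sector s (x - y) - sector s (z - y)) Dq => D Dq.
    by case/orP: k13 => /eqP ->; case=> HD; case: Dq => ED; rewrite ED in HD; clear -HD; lia.
  by case/or3P: g => // b; [have := H 1%N isT | have := H 3%N isT]; rewrite b.
move=> n; apply/negP => /eqP E.
suff : sector s (x - y) = sector s (z - y) + 8 * (2 * n + 1).
  by move: Dq; move: (sector s (x - y)) (sector s (z - y)) => a b; case=> Dq ED; clear -Dq ED; lia.
rewrite {1}/sector E; apply: floor_uniq.
have := sector_bound s (z - y).
have -> : 8 * (angle (z - y) + (2 * n + 1)%:~R * pi) / pi =
    8 * angle (z - y) / pi + 8 * (2 * n + 1)%:~R :> R.
  by move: (pi : R) p0 => p' p0; field; rewrite gt_eqF.
by rewrite intrD intrM => ?; lra.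
Qed.

(** The elastic energy of a bond above the minimum [-1]; on a bond it vanishes only at length 1. *)
Definition excess x y : R := if near x y then v (dist (pos x) (pos y)) + 1 else 0.

Lemma excess_ge0 x y : 0 <= excess x y.
Proof.
rewrite /excess; case: ifP => // _; have := v_ge (dist_ge0 (pos x) (pos y)); lra.
Qed.

Lemma excess_eq0 x y : near x y -> excess x y = 0 -> dist (pos x) (pos y) = 1.
Proof.
by rewrite /excess => -> E; apply: v_min; [exact: dist_ge0 | lra].
Qed.

Lemma v_excess x y : x != y -> v (dist (pos x) (pos y)) = excess x y - (near x y)%:R.
Proof.
move=> xy; rewrite /excess; case: ifP => [_|]; first by rewrite addrK.
by rewrite /near /= xy /= => /negbT; rewrite -leNgt => /v_far ->; rewrite subr0.
Qed.

Lemma pair_energyE (A : {set T}) : pair_energy A =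
  \sum_(x in A) \sum_(y in A | y != x) excess x y - #|bonds A near|%:R.
Proof.
have -> : #|bonds A near| = (\sum_(x in A) \sum_(y in A | y != x) near x y)%N.
  rewrite pair_big_dep /= -sum1_card big_mkcond [RHS]big_mkcond; apply: eq_bigr => -[x y] _.
  rewrite inE /=; case: (x \in A) => //; case: (y \in A) => //=.
  by case: (eqVneq y x) => [->|_]; rewrite ?near_irr //; case: near.
rewrite natr_sum -sumrB; apply: eq_bigr => x _; rewrite natr_sum -sumrB.
by apply: eq_bigr => y /andP[_ yx]; rewrite v_excess // eq_sym.
Qed.

Lemma sub_energyE (A : {set T}) : (forall q, q \in A -> q \notin sub) ->
  sub_energy A = \sum_(x in A) \sum_(z in sub) excess x z - #|contacts A sub near|%:R.
Proof.
move=> A_sub.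
have -> : #|contacts A sub near| = (\sum_(x in A) \sum_(z in sub) near x z)%N.
  rewrite pair_big_dep /= -sum1_card big_mkcond [RHS]big_mkcond; apply: eq_bigr => -[x y] _.
  by rewrite inE /=; case: (x \in A) => //; case: (y \in sub) => //=; case: near.
rewrite natr_sum -sumrB; apply: eq_bigr => x xA; rewrite natr_sum -sumrB.
by apply: eq_bigr => z zs; rewrite v_excess //; apply: contraTneq zs => <-; exact: A_sub.
Qed.

Lemma window_tri (A : {set T}) p z e : (forall q, q \in A -> q \notin sub) ->
  p \in A -> z \in sub -> near p z -> norm2 e = 1 -> Lminus (pos z + e) ->
  exists2 z', tri A (p, z, z') & pos z' - pos z = e.
Proof.
move=> A_sub pA zs pz e1 Le; have [z' z's E] := sub_window (A_sub p pA) zs pz e1 Le.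
exists z'; last by rewrite E addrC addKr.
rewrite /tri /= !inE pA zs z's pz !orbT /=.
have -> : p != z' by apply: contraTneq z's => <-; exact: A_sub.
rewrite /near /= norm2_dist E -norm2N opprB addrC addKr e1 r0_gt1 andbT /=.
apply: contra_eq_neq E => ->; rewrite -subr_eq0 opprD addNKr oppr_eq0.
apply: contra_eq_neq e1 => ->; rewrite /norm2 /= expr0n addr0 sqrtr0.
by rewrite eq_sym oner_eq0.
Qed.

Lemma sub_steps z : z \in sub ->
  [/\ Lminus (pos z + ex), Lminus (pos z - ex) & Lminus (pos z - ey)].
Proof.
case/sub_lattice => a [b [-> b0]]; split.
- by exists (a + 1), b; split=> //; rewrite intrD -[b%:~R in RHS]addr0.
- by exists (a - 1), b; split=> //; rewrite intrB -[b%:~R in RHS]subr0.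
- exists a, (b - 1); split; last by move: b0; clear; lia.
  by rewrite intrB -[a%:~R in RHS]subr0.
Qed.

Lemma norm2_axes : norm2 (ex) = 1 /\ norm2 (ey) = 1.
Proof. by rewrite /ex /ey /norm2 /= expr0n expr1n addr0 add0r sqrtr1. Qed.

(** A contact makes good angles with the substrate bonds from [z] along [ex], [- ex] and [- ey],
    which always exist; only directions within one sector of [ey] do so. *)
Lemma osec_contact (A : {set T}) s p z : (forall q, q \in A -> q \notin sub) ->
  (forall t, tri A t -> good (ang3 t)) -> 0 <= s < 1 ->
  p \in A -> z \in sub -> near p z ->
  (((osec s ex + 4) %% 16).-1 <= osec s (pos p - pos z)%R <= ((osec s ex + 4) %% 16).+1)%N.
Proof.
move=> A_sub reg s01 pA zs pz.
have R3 e : norm2 e = 1 -> Lminus (pos z + e) -> right_diff (osec s (pos p - pos z)) (osec s e).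
  move=> e1 Le; have [z' t <-] := window_tri A_sub pA zs pz e1 Le.
  have := reg _ t; case/and5P: t => _ _ _ _ /andP[/= n1 n2].
  by apply: right_of_good; apply: near_pos; rewrite // near_sym.
have [L1 L2 L3] := sub_steps zs; have [N1 N2] := norm2_axes.
have := R3 _ N1 L1.
have := R3 (- ex); rewrite norm2N => /(_ N1 L2).
have := R3 (- ey); rewrite norm2N => /(_ N2 L3).
have [+ -> ->] := osec_axes s01.
move: (osec_lt s (pos p - pos z)); rewrite /right_diff /absdiff.
move: (osec s (pos p - pos z)) (osec s ex) => x e x16.
by clear -x16; case=> ->; lia.
Qed.

(** * Rigidity in the case of equality *)

Definition axis (u : R * R) : Prop := [\/ u = ex, u = - ex, u = ey | u = - ey].

Lemma axisN u : axis u -> axis (- u).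
Proof.
by case=> ->; rewrite ?opprK; [apply: Or42 | apply: Or41 | apply: Or44 | apply: Or43].
Qed.

Lemma norm2_axis u : axis u -> norm2 u = 1.
Proof. by have [n1 n2] := norm2_axes; case=> ->; rewrite ?norm2N. Qed.

Lemma axis_intro (a b : R) : a ^+ 2 + b ^+ 2 = 1 -> a = 0 \/ b = 0 -> axis (a, b).
Proof.
move=> ab; case=> E; rewrite E expr0n ?addr0 ?add0r in ab *.
- have /orP[] : (b == 1) || (b == -1) by rewrite -sqrf_eq1 ab.
    by move/eqP=> ->; apply: Or43.
  by move/eqP=> ->; apply: Or44; rewrite /ey -[RHS]/(- 0, - 1) oppr0.
- have /orP[] : (a == 1) || (a == -1) by rewrite -sqrf_eq1 ab.
    by move/eqP=> ->; apply: Or41.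
  by move/eqP=> ->; apply: Or42; rewrite /ex -[RHS]/(- 1, - 0) oppr0.
Qed.

Lemma axis_right u w : norm2 u = 1 -> axis w -> cosine u w = 0 \/ cosine u w = -1 -> axis u.
Proof.
move=> u1 aw; rewrite /cosine u1 (norm2_axis aw) mulr1 divr1.
have := norm2_sqr u; rewrite u1 expr1n; case: u u1 => a b _ /= /esym ab.
have Ea c : c ^+ 2 = 1 -> a = 0 \/ a = c -> axis (a, b).
  move=> c1 H; apply: axis_intro => //; case: H => [|ac]; [by left | right].
  by apply/eqP; rewrite -sqrf_eq0; apply/eqP; rewrite ac c1 in ab; lra.
have Eb c : c ^+ 2 = 1 -> b = 0 \/ b = c -> axis (a, b).
  move=> c1 H; apply: axis_intro => //; case: H => [|bc]; [by right | left].
  by apply/eqP; rewrite -sqrf_eq0; apply/eqP; rewrite bc c1 in ab; lra.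
have i1 : (-1) ^+ 2 = 1 :> R by rewrite sqrrN expr1n.
case: aw => -> /= H; [apply: (Ea (-1)) | apply: (Ea 1) | apply: (Eb (-1)) | apply: (Eb 1)];
  rewrite ?expr1n //; by case: H => H; [left | right]; lra.
Qed.

Lemma cosine_right (A : {set T}) t : tri A t -> v3 (ang3 t) = 0 ->
  cosine (pos t.1.1 - pos t.1.2) (pos t.2 - pos t.1.2) = 0 \/
  cosine (pos t.1.1 - pos t.1.2) (pos t.2 - pos t.1.2) = -1.
Proof.
move=> tA E; have /andP[t0 t2] := ang3_range tA.
have [h1 [h2 [h3 h4]]] := v3_right.
case/and5P: tA => _ _ _ _ /andP[/near_pos n1]; rewrite near_sym => /near_pos n2.
rewrite -(cos_theta n1 n2) -/(ang3 t).
case: (eqVneq (ang3 t) (pi / 2)) => [->|m1]; first by left; exact: cos_pihalf.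
case: (eqVneq (ang3 t) pi) => [->|m2]; first by right; exact: cospi.
case: (eqVneq (ang3 t) (3 * pi / 2)) => [->|m3].
  left; have -> : 3 * pi / 2 = pi / 2 + pi :> R by lra.
  by rewrite cosDpi cos_pihalf oppr0.
by have := h4 _ t0 t2 m1 m2 m3; rewrite E ltxx.
Qed.

Definition bottom (A : {set T}) : {set T} := [set p in A | (pos p).2 == 1].

Definition conclusion (A : {set T}) : Prop :=
  (forall p, p \in A -> exists a b : int, pos p = (a%:~R, b%:~R)) /\
  #|A|%:R / (hstar beta #|A|)%:R <= #|bottom A|%:R :> R.

Section Rigid.
Variable A : {set T}.
Hypothesis A_sub : forall q, q \in A -> q \notin sub.
Hypothesis angle0 : forall t, tri A t -> v3 (ang3 t) = 0.
Hypothesis bond1 : forall x y, x \in A -> y \in nbr A sub near x -> dist (pos x) (pos y) = 1.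

(** The bond directions belong to the invariant: without them it would not pass to neighbours. *)
Definition latticed p : Prop := (exists a b : int, pos p = (a%:~R, b%:~R)) /\
  forall y, y \in nbr A sub near p -> axis (pos y - pos p).

(** Cosines 0 or -1 with both [ex] and [- ex] kill the horizontal component; then positive height
    leaves only [z + ey] with [z] in the top row. *)
Lemma rigid_contact p z : p \in A -> z \in sub -> near p z ->
  pos p = pos z + ey /\ (pos p).2 = 1.
Proof.
move=> pA zs pz; have zn : z \in nbr A sub near p by rewrite !inE zs pz orbT.
have [L1 L2 L3] := sub_steps zs; have [N1 N2] := norm2_axes.
have n1 : norm2 (pos p - pos z) = 1 by exact: bond1 zn.
have C e : norm2 e = 1 -> Lminus (pos z + e) ->
    cosine (pos p - pos z) e = 0 \/ cosine (pos p - pos z) e = -1.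
  move=> e1 Le; have [z' t <-] := window_tri A_sub pA zs pz e1 Le.
  exact: (cosine_right t (angle0 t)).
have c1 := C ex N1 L1; have c2 : _ := C (- ex) _ L2.
rewrite norm2N in c2; move/(_ N1): c2 => c2.
have := above (A_sub pA); have := norm2_sqr (pos p - pos z); rewrite n1 expr1n.
move: c1 c2; rewrite /cosine norm2N n1 N1 mulr1 !divr1.
have := sub_lattice zs; case=> a [b [-> b0]].
case: (pos p) => x y /=; rewrite !mulr1 !mulr0 !addr0 ?mulrN ?oppr0 ?mulr0 ?addr0 ?mulr1.
move=> c1 c2 /esym n y0.
have x0 : x - a%:~R = 0 by case: c1 => c1; case: c2 => c2; lra.
have b0' : b%:~R <= 0 :> R by rewrite lerz0.
rewrite x0 expr0n add0r in n.
have /orP[] : (y - b%:~R == 1) || (y - b%:~R == -1) by rewrite -sqrf_eq1 n.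
  move/eqP => E; have yb : y = (b + 1)%:~R by rewrite intrD; lra.
  have b1 : b = 0.
    by move: b0 y0; rewrite yb ltr0z; clear; lia.
  rewrite yb b1; split=> //; congr pair => /=; first by rewrite addr0; lra.
  by rewrite intrD.
move/eqP => E; have yb : y = (b - 1)%:~R by rewrite intrB; lra.
by exfalso; move: b0 y0; rewrite yb ltr0z; clear; lia.
Qed.

Lemma latticed_contact p z : p \in A -> z \in sub -> near p z -> latticed p.
Proof.
move=> pA zs pz; have [E _] := rigid_contact pA zs pz.
split.
  have [a [b [Ez b0]]] := sub_lattice zs; exists a, (b + 1).
  by rewrite E Ez intrD -[a%:~R in RHS]addr0.
have zn : z \in nbr A sub near p by rewrite !inE zs pz orbT.
have az : axis (pos z - pos p) by rewrite E opprD addNKr; apply: Or44.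
move=> y yn; case: (eqVneq y z) => [->//|yz].
have t := tri_center pA yn zn yz.
apply: axis_right az (cosine_right t (angle0 t)).
by rewrite -norm2N opprB; exact: bond1 yn.
Qed.

Lemma latticed_step p q : p \in A -> q \in A -> near p q -> latticed p -> latticed q.
Proof.
move=> pA qA pq [[a [b Ep]] ax].
have qn : q \in nbr A sub near p by rewrite !inE qA pq.
have pn : p \in nbr A sub near q by rewrite !inE pA near_sym pq.
have aq := ax q qn.
split.
  have [e ae ->] : exists2 e, axis e & pos q = pos p + e.
    by exists (pos q - pos p) => //; rewrite addrC subrK.
  rewrite Ep; case: ae => ->.
  - by exists (a + 1), b; rewrite intrD -[b%:~R in RHS]addr0.
  - by exists (a - 1), b; rewrite intrB -[b%:~R in RHS]subr0.
  - by exists a, (b + 1); rewrite intrD -[a%:~R in RHS]addr0.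
  - by exists a, (b - 1); rewrite intrB -[a%:~R in RHS]subr0.
have ap : axis (pos p - pos q) by rewrite -opprB; exact: axisN.
move=> y yn; case: (eqVneq y p) => [->//|yp].
have t := tri_center qA yn pn yp.
apply: axis_right ap (cosine_right t (angle0 t)).
by rewrite -norm2N opprB; exact: bond1 yn.
Qed.

Lemma rigid_bottom : (#|contacts A sub near| <= #|bottom A|)%N.
Proof.
have <- : #|fst @: contacts A sub near| = #|contacts A sub near|.
  apply: card_in_imset => -[p z] [p' z']; rewrite !inE /= => /and3P[pA zs pz].
  case/and3P=> p'A z's p'z' E; subst p'; congr pair; apply: pos_inj.
  have [E _] := rigid_contact pA zs pz; have [E' _] := rigid_contact pA z's p'z'.
  by apply: (addIr ey); rewrite -E -E'.
apply: subset_leq_card; apply/subsetP => _ /imsetP[[p z] + ->].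
rewrite !inE => /and3P[/= pA zs pz]; rewrite pA.
by have [_ ->] := rigid_contact pA zs pz; rewrite eqxx.
Qed.

End Rigid.

(** * The lower bound in a window *)

Definition osec_pos s x y := osec s (pos y - pos x).

(** A cut is a straight triple whose directions, one of them reversed, are separated by the shifted
    floor. [floor_shift] finds a shift with at most as many cuts as the total bend in units of
    [pi / 8], and [v3_bend] charges 5 per unit. *)
Lemma cuts_angle (A : {set T}) : (forall t, tri A t -> good (ang3 t)) -> exists s,
  0 <= s < 1 /\
  5 * #|cuts A sub near (osec_pos s)|%:R <= angle_energy A.
Proof.
move=> reg; have p0 := pi_gt0 R.
have tpos t : tri A t -> pos t.1.1 != pos t.1.2 /\ pos t.2 != pos t.1.2.
  by case/and5P=> _ _ _ _ /andP[/near_pos n1]; rewrite near_sym => /near_pos.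
pose ang_l (t : T * T * T) := angle (pos t.1.1 - pos t.1.2).
pose ang_r (t : T * T * T) := angle (pos t.2 - pos t.1.2).
have H t : exists n : int, tri A t ->
    `|ang_l t - (ang_r t + (2 * n + 1)%:~R * pi)| = `|ang3 t - pi|.
  case: (boolP (tri A t)) => tA; last by exists 0.
  by have [n1 n2] := tpos t tA; have [m E] := straight_angle n1 n2; exists m.
have [n nP] := boolp.choice H.
pose P := [set t | tri A t && inband 2 (ang3 t)].
pose a t := 8 * ang_l t / pi; pose b t := 8 * (ang_r t + (2 * n t + 1)%:~R * pi) / pi.
have [s [s0 s1 cnt]] := floor_shift P a b.
exists s; rewrite s0 s1; split=> //.
have cutP : (#|cuts A sub near (osec_pos s)| <=
    #|[set t in P | Num.floor (a t - s) != Num.floor (b t - s)]|)%N.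
  apply: subset_leq_card; apply/subsetP => -[[y p] w]; rewrite inE => /and4P[/= pA yp wp c].
  have yw : y != w.
    by apply: contraTneq c => ->; rewrite /cut_diff /absdiff subnn.
  have tA := tri_center pA yp wp yw; have [n1 n2] := tpos _ tA.
  have [b2 ne] := cut_straight n1 n2 (reg _ tA) c.
  by rewrite !inE tA b2 /= ne.
have le : \sum_(t in P) `|a t - b t| <= \sum_(t in P) 5^-1 * v3 (ang3 t).
  apply: ler_sum => t; rewrite inE => /andP[tA b2].
  have -> : a t - b t = 8 / pi * (ang_l t - (ang_r t + (2 * n t + 1)%:~R * pi)).
    by rewrite /a /b; move: (pi : R) p0 => q q0; field; rewrite gt_eqF.
  rewrite normrM nP // (ger0_norm (_ : 0 <= 8 / pi)); last by rewrite divr_ge0 // ltW.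
  by have := v3_bend b2; lra.
have le2 : \sum_(t in P) v3 (ang3 t) <= angle_energy A.
  rewrite /angle_energy [leRHS](bigID (mem P)) /= -[leLHS]addr0; apply: lerD.
    by rewrite le_eqVlt; apply/orP; left; apply/eqP/eq_bigl => t; rewrite inE; case: (tri A t).
  by apply: sumr_ge0 => t /andP[tA _]; exact: v3_tri_ge0 tA.
move: cutP; rewrite -(ler_nat R) -mulr_sumr in le *; lra.
Qed.

(** Half the angle energy pays for half the cuts with at least two fifths of the angle energy to
    spare; [chain_count] and [chain_optimum] then bound what is left besides nonnegative
    excesses. *)
Lemma regular_case (A : {set T}) : (forall q, q \in A -> q \notin sub) -> (0 < #|A|)%N ->
  (forall t, tri A t -> good (ang3 t)) ->
  - 2 * #|A|%:R + 2^-1 * mbeta beta #|A| <= fenergy A /\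
  (fenergy A <= - 2 * #|A|%:R + 2^-1 * mbeta beta #|A| -> conclusion A).
Proof.
move=> A_sub A0 reg; have [s [s01 cutE]] := cuts_angle reg.
pose o := osec_pos s.
have oB x y : pos x - pos y = - (pos y - pos x) by rewrite opprB.
have [||||||n [a [[sa an sN] Na nB conn]]] :=
  @chain_count T A sub near o A_sub near_sym near_irr _ _ _ _ ((osec s ex + 4) %% 16)%N.
- by move=> x y; exact: osec_lt.
- by move=> x y xy; rewrite /o /osec_pos oB osecN // pos_sub_neq // eq_sym.
- move=> x y z xy yz E.
  have [] := osec_cone (pos_sub_neq (_ : y != x)) (pos_sub_neq (_ : z != y)) E; rewrite 1?eq_sym //.
  rewrite addrC addrA subrK => xz Exz; split=> //.
  by apply: contraNneq xz => ->; rewrite subrr.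
- move=> p y w pA yp wp yw; have t := tri_center pA yp wp yw.
  have := reg _ t; case/and5P: t => _ _ _ _ /andP[/= n1 n2].
  by apply: right_of_good; apply: near_pos; rewrite // near_sym.
- by move: (osec_axes s01) => [+ _ _]; case=> ->; exact: erefl.
- by move=> p z pA zs pz; exact: (osec_contact A_sub reg s01).
set N := #|A| in A0 sN Na nB *.
have [opt1 opt2] := @chain_optimum R beta beta_gt0 N n a _ A0 (introT andP (conj sa an)) sN Na.
pose X1 := \sum_(x in A) \sum_(y in A | y != x) excess x y.
pose X2 := \sum_(x in A) \sum_(z in sub) excess x z.
have X1_ge0 : 0 <= X1 by apply: sumr_ge0 => x _; apply: sumr_ge0 => y _; exact: excess_ge0.
have X2_ge0 : 0 <= X2 by apply: sumr_ge0 => x _; apply: sumr_ge0 => y _; exact: excess_ge0.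
have S_ge0 : 0 <= angle_energy A by apply: sumr_ge0 => t tA; exact: v3_tri_ge0 tA.
have EE : fenergy A = 2^-1 * (X1 - #|bonds A near|%:R) +
    beta * (X2 - #|contacts A sub near|%:R) + 2^-1 * angle_energy A.
  by rewrite /fenergy pair_energyE sub_energyE.
have nB' : 2 * n%:R + #|bonds A near|%:R <= 4 * N%:R + #|cuts A sub near o|%:R :> R.
  by rewrite -!natrM -!natrD ler_nat.
have bX2 : 0 <= beta * X2 by rewrite mulr_ge0 // ltW.
rewrite EE; split; first by rewrite mulrBr; lra.
rewrite mulrBr => le.
have [sa_eq sN2] : #|contacts A sub near| = a /\
    N%:R / (hstar beta N)%:R <= #|contacts A sub near|%:R :> R.
  by apply: opt2; lra.
(* At equality each surplus vanishes: both excesses and the part of the angle energy not spent on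
   cuts. *)
have X1_0 : X1 = 0 by apply/le_anti; rewrite X1_ge0 andbT; lra.
have X2_0 : beta * X2 = 0 by apply/le_anti; rewrite bX2 andbT; lra.
have S_0 : angle_energy A = 0 by apply/le_anti; rewrite S_ge0 andbT; lra.
have angle0 t : tri A t -> v3 (ang3 t) = 0.
  by move=> tA; apply: (psumr_eq0P _ S_0) => // u uA; exact: v3_tri_ge0 uA.
have bond1 x y : x \in A -> y \in nbr A sub near x -> dist (pos x) (pos y) = 1.
  move=> xA; rewrite !inE => /andP[/orP[yA|ys] xy]; apply: excess_eq0 => //.
    have H := psumr_eq0P _ X1_0; have := H (fun x _ => sumr_ge0 _ (fun y _ => excess_ge0 x y)) x xA.
    move/(psumr_eq0P (fun y _ => excess_ge0 x y)); apply; rewrite yA.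
    by case/andP: xy; rewrite eq_sym.
  have {}X2_0 : X2 = 0 by move/eqP: X2_0; rewrite mulf_eq0 gt_eqF //= => /eqP.
  have H := psumr_eq0P _ X2_0; have := H (fun x _ => sumr_ge0 _ (fun y _ => excess_ge0 x y)) x xA.
  by move/(psumr_eq0P (fun y _ => excess_ge0 x y)); apply.
split.
  have L : forall p, p \in A -> latticed A p.
    apply: (conn sa_eq (latticed A)); first by move=> q r qA rA qr; exact: latticed_step.
    by move=> q z qA zs qz; exact: (latticed_contact A_sub angle0 bond1 qA zs qz).
  by move=> p /L[].
by apply: le_trans sN2 _; rewrite ler_nat; exact: rigid_bottom.
Qed.

Lemma tri_sub (A : {set T}) t : tri A t -> t.1.1 \in sub -> t.1.2 \in sub -> t.2 \in sub ->
  good (ang3 t).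
Proof.
case/and5P=> _ _ _ xz /andP[/andP[xy dxy] /andP[yz dyz]].
move=> /sub_lattice Lx /sub_lattice Ly /sub_lattice Lz.
rewrite eq_sym in yz; rewrite distC in dyz.
have := lattice_right Lx Ly Lz (pos_neq xy) (pos_neq yz) (pos_neq xz)
  (lt_trans dxy r0_lt) (lt_trans dyz r0_lt).
rewrite /good /inband -/(ang3 t).
have e0 := ltW eps_gt0; have p0 := pi_gt0 R.
case=> [|[|]] ->.
- by rewrite mul1r subrr normr0 e0.
- by rewrite [2 * _]mulrC mulfK // subrr normr0 e0 orbT.
- by rewrite subrr normr0 e0 !orbT.
Qed.

(** Induction on the number of particles: a bad triple contains a particle, since substrate angles
    are right, and deleting it leads to a strictly larger bound. *)
Lemma fenergy_lower (A : {set T}) : (forall q, q \in A -> q \notin sub) -> (0 < #|A|)%N ->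
  - 2 * #|A|%:R + 2^-1 * mbeta beta #|A| <= fenergy A /\
  (fenergy A <= - 2 * #|A|%:R + 2^-1 * mbeta beta #|A| -> conclusion A).
Proof.
move: {2}(#|A|) (erefl #|A|) => N; elim: N A => [|N IH] A AN A_sub A0; first by rewrite AN in A0.
have [/forallP reg|/forallPn[t]] := boolP [forall t, tri A t ==> good (ang3 t)].
  by apply: regular_case => // t tA; move: (reg t); rewrite tA.
rewrite negb_imply => /andP[tA tbad].
have [p pA pt] : exists2 p, p \in A & (p == t.1.1) || (p == t.1.2) || (p == t.2).
  have := tA; case/and5P; rewrite !inE => x y z _ _.
  case/orP: x => [|xs]; first by exists t.1.1; rewrite ?eqxx.
  case/orP: y => [|ys]; first by exists t.1.2; rewrite ?eqxx ?orbT.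
  case/orP: z => [|zs]; first by exists t.2; rewrite ?eqxx ?orbT.
  by rewrite (tri_sub tA xs ys zs) in tbad.
have rem := removal A_sub tA tbad pA pt.
have Ap : #|A :\ p| = N by move: AN; rewrite (cardsD1 p) pA => -[].
suff lt : - 2 * #|A|%:R + 2^-1 * mbeta beta #|A| < fenergy A.
  by split; [exact: ltW | rewrite leNgt lt].
apply: lt_le_trans rem; rewrite AN.
case: (posnP N) => [N0|N0]; last first.
  have Ap_sub q : q \in A :\ p -> q \notin sub by move=> /setD1P[_]; exact: A_sub.
  have [] := IH (A :\ p) Ap Ap_sub _; first by rewrite Ap.
  rewrite Ap => H _; apply: lt_le_trans H.
  by have := @mbeta_step R beta beta_gt0 N N0; rewrite -[N.+1%:R]natr1; lra.
(* Without particles the energy is nonnegative, while the bound for one particle is at most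
   [- beta]. *)
have E0 : A :\ p = set0 by apply/eqP; rewrite -cards_eq0 Ap N0.
have F0 : 0 <= fenergy (A :\ p).
  rewrite /fenergy /pair_energy /sub_energy E0 !big_set0 !mulr0 !add0r mulr_ge0 //.
  by apply: sumr_ge0 => u uA; exact: v3_tri_ge0 uA.
apply: lt_le_trans F0; rewrite N0.
have := @mbeta_le R beta 1 1 isT; rewrite mfun1; move: beta_gt0; lra.
Qed.

End FiniteEnergy.

(** * Reduction to a finite window *)

Section Window.
Import fintype boot.finset.
Local Open Scope ring_scope.
Variable R : realType.

Lemma fsbig_window (I : choiceType) (T : finType) (P : pred T) (h : T -> I)
    (D : classical_sets.set I) (F : I -> \bar R) :
  {in P &, injective h} -> (forall t, P t -> D (h t)) ->
  (forall i, D i -> (forall t, P t -> i <> h t) -> F i = 0%E) ->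
  (\sum_(i \in D) F i = \sum_(t | P t) F (h t))%E.
Proof.
move=> h_inj hD F0; rewrite (@fsbigE _ _ _ _ _ [seq h t | t <- enum P]).
- rewrite big_map -[RHS]big_enum /= [LHS]big_seq_cond [RHS]big_seq_cond; apply: eq_bigl => t.
  rewrite mem_enum andbT; apply: andb_idr => tP.
  by apply/classical_sets.mem_set/hD.
- rewrite map_inj_in_uniq ?enum_uniq // => s t; rewrite !mem_enum; exact: h_inj.
- by move=> i /mapP[t]; rewrite mem_enum => tP ->; exact: hD.
- move=> i Di; move/mapP => no; apply: F0 => // t tP E; apply: no.
  by exists t; rewrite ?mem_enum.
Qed.

Lemma dist_coord (p q : R * R) : `|p.1 - q.1| <= dist p q /\ `|p.2 - q.2| <= dist p q.
Proof.
by rewrite -!sqrtr_sqr /dist; split; apply: ler_wsqrtr; rewrite ?lerDl ?lerDr sqr_ge0.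
Qed.

Variables (N : nat) (x : 'I_N -> R * R) (K : nat) (r0 : R).
Hypothesis x_inj : injective x.
Hypothesis x_gt0 : forall i, 0 < (x i).2.
Hypothesis K_large : forall i, `|(x i).1| + 5 <= K%:R /\ `|(x i).2| + 5 <= K%:R.
Hypothesis r0_lt : r0 < Num.sqrt 2.

(** The particles together with a lattice box: columns [- K] to [K], rows [- K] to 0. *)
Definition wpt : finType := ('I_N + 'I_K.*2.+1 * 'I_K.+1)%type.

Definition wpos (t : wpt) : R * R :=
  match t with
  | inl i => x i
  | inr (a, b) => ((a%:Z - K%:Z)%:~R, (- b%:Z)%:~R)
  end.

Definition wsub : {set wpt} := [set t | if t is inr _ then true else false].
Definition wpart : {set wpt} := [set t | if t is inl _ then true else false].

Lemma wpos_sub t : t \in wsub -> Lminus (wpos t).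
Proof.
case: t => [i|[a b]]; rewrite inE // => _.
by exists (a%:Z - K%:Z), (- b%:Z); split; rewrite ?oppr_le0.
Qed.

Lemma wpos_above t : t \notin wsub -> 0 < (wpos t).2.
Proof. by case: t => [i|[a b]]; rewrite inE //= => _. Qed.

Lemma wpos_inj : injective wpos.
Proof.
have L0 ab : (wpos (inr ab)).2 <= 0.
  have : inr ab \in wsub by rewrite inE.
  by case/wpos_sub => a [b [-> b0]] /=; rewrite lerz0.
move=> [i|ab] [j|cd] E.
- by congr inl; exact: x_inj.
- by have := L0 cd; rewrite -E /= leNgt x_gt0.
- by have := L0 ab; rewrite E /= leNgt x_gt0.
- case: ab cd E => [a b] [c d] /= [/intr_inj E1 /intr_inj E2]; congr (inr (_, _));
    apply/val_inj => /=; clear -E1 E2; lia.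
Qed.

Lemma in_window (q : R * R) : Lminus q -> `|q.1| <= K%:R -> `|q.2| <= K%:R ->
  exists2 t, t \in wsub & wpos t = q.
Proof.
case=> a [b [-> b0]] /=; rewrite -!intr_norm !pmulrn !ler_int => aK bK.
exists (inr (inord (absz (a + K%:Z)), inord (absz b))); first by rewrite inE.
by rewrite /= !inordK; [congr (_%:~R, _%:~R) | |]; clear -b0 aK bK; lia.
Qed.

Lemma sqrt2_lt2 : Num.sqrt 2 < 2 :> R.
Proof.
rewrite -[ltRHS]ger0_norm // -sqrtr_sqr ltr_sqrt ?exprn_gt0 // expr2; lra.
Qed.

(** Leaves room for one more bond inside the box. The margin 5 in [K_large] is this 3 plus 2 for a
    first bond. *)
Definition central (q : R * R) := `|q.1| + 3 <= K%:R /\ `|q.2| + 3 <= K%:R.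

Lemma dist_coord2 (p q : R * R) : dist p q < 2 -> `|q.1| <= `|p.1| + 2 /\ `|q.2| <= `|p.2| + 2.
Proof.
move=> dq; have [c1 c2] := dist_coord p q.
have := ler_distD p.1 0 q.1; have := ler_distD p.2 0 q.2.
have := ler_normD (q.1 - p.1) p.1; have := ler_normD (q.2 - p.2) p.2.
by rewrite !subrK (distrC q.1) (distrC q.2); split; lra.
Qed.

Lemma central_part i : central (x i).
Proof. by have [k1 k2] := K_large i; split; lra. Qed.

Lemma central_near i (q : R * R) : dist (x i) q < 2 -> central q.
Proof.
by move=> /dist_coord2[c1 c2]; have [k1 k2] := K_large i; split; lra.
Qed.

Lemma central_window (q u : R * R) : central q -> dist q u < 2 -> Lminus u ->
  exists2 t, t \in wsub & wpos t = u.
Proof. by move=> [q1 q2] /dist_coord2[c1 c2] Lu; apply: in_window => //; lra. Qed.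

Lemma wsub_window p z e : p \notin wsub -> z \in wsub -> near r0 wpos p z ->
  norm2 e = 1 -> Lminus (wpos z + e) -> exists2 z', z' \in wsub & wpos z' = wpos z + e.
Proof.
case: p => [i _|ab]; last by rewrite inE.
move=> zs /andP[_ dz] e1 Le.
have d2 : dist (x i) (wpos z) < 2 by apply: lt_trans dz (lt_trans r0_lt sqrt2_lt2).
apply: (central_window (central_near d2)) => //.
by rewrite norm2_dist opprD addNKr norm2N e1; lra.
Qed.

Lemma big_wpart (F : wpt -> R) (Q : pred wpt) :
  \sum_(t in wpart | Q t) F t = \sum_(i | Q (inl i)) F (inl i).
Proof.
rewrite big_sumType /= [X in _ + X]big_pred0 ?addr0; last by move=> ab; rewrite inE.
by apply: eq_bigl => i; rewrite inE.
Qed.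

(** * Comparing the full energy with the window energy *)

Variables (beta : R) (v2 : R -> \bar R) (v3 : R -> R).
Hypothesis beta_gt0 : 0 < beta.
Hypothesis v2_ge : forall r, 0 <= r -> ((-1)%:E <= v2 r)%E.
Hypothesis v2_far : forall r, r0 <= r -> v2 r = 0%E.
Hypothesis v3_right : cond_ii3 v3.

(* Capping [v2] at [1] makes it real-valued without touching the ground state. *)
Definition cap r : R := fine (Order.min (v2 r) 1%E).

Lemma capE r : 0 <= r -> (cap r)%:E = Order.min (v2 r) 1%E.
Proof.
move=> r0'; rewrite /cap fineK // fin_numElt; apply/andP; split.
  by rewrite lt_min ltNyr (lt_le_trans (ltNyr _) (v2_ge r0')).
by rewrite gt_min ltry orbT.
Qed.

Lemma cap_le r : 0 <= r -> ((cap r)%:E <= v2 r)%E.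
Proof. by move=> r0'; rewrite capE // ge_min lexx. Qed.

Lemma cap_ge r : 0 <= r -> -1 <= cap r.
Proof. by move=> r0'; rewrite -lee_fin capE // le_min v2_ge //= lee_fin; lra. Qed.

Lemma cap_far r : r0 <= r -> cap r = 0.
Proof. by move=> /v2_far E; rewrite /cap E min_l ?lee_fin. Qed.

Lemma cap_min r : 0 <= r -> cap r = -1 -> v2 r = (-1)%:E.
Proof.
move=> r0' E; have := capE r0'; rewrite E /Order.min; case: ifP => _; first by move=> ->.
by case=> /eqP; rewrite eqNr oner_eq0.
Qed.

Local Notation wnear := (near r0 wpos).
Local Notation wtri := (tri r0 wpos wsub wpart).

Definition wpos3 (t : wpt * wpt * wpt) := (wpos t.1.1, wpos t.1.2, wpos t.2).

Lemma wpart_sub t : t \in wpart :|: wsub.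
Proof. by case: t => [i|ab]; rewrite !inE ?orbT. Qed.

Lemma wpos_all t : allpts x (wpos t).
Proof.
by case: t => [i|ab]; [left; exists i | right; apply: wpos_sub; rewrite inE].
Qed.

Lemma central_allpts (q u : R * R) : central q -> dist q u < 2 -> allpts x u ->
  exists t, wpos t = u.
Proof.
move=> cq dq [[j _ <-]|Lu]; first by exists (inl j).
by have [t _ E] := central_window cq dq Lu; exists t.
Qed.

(** The middle point of a triple containing a particle is central, so the whole triple lies in the
    window; all other triples are within the substrate and vanish. *)
Lemma triple_sum : (\sum_(t \in triples r0 x) (v3 (theta t.1.1 t.1.2 t.2))%:E =
  (angle_energy r0 v3 wpos wsub wpart)%:E)%E.
Proof.
rewrite (@fsbig_window _ _ wtri wpos3).
- by rewrite /angle_energy sumEFin.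
- move=> [[a b] c] [[a' b'] c'] _ _ [] E1 E2 E3.
  by rewrite (wpos_inj E1) (wpos_inj E2) (wpos_inj E3).
- move=> [[a b] c] /and5P[/= _ _ _ ac /andP[/andP[ab dab] /andP[bc dbc]]].
  rewrite /triples /=; do 3 (split; first exact: wpos_all).
  split; [|split; [|split; [|split]]] => //; move/wpos_inj => E; move: ab bc ac; rewrite E eqxx //.
- move=> [[p q] s] /= [Ap [Aq [As [pq [qs [ps [dpq dqs]]]]]]] no.
  have lt2 := lt_trans r0_lt sqrt2_lt2.
  have [[i Ei]|np] := pselect (exists i, x i = p \/ x i = q \/ x i = s).
    exfalso.
    have dqp : dist q p < 2 by rewrite distC; apply: lt_trans dpq lt2.
    have dqs' : dist q s < 2 by apply: lt_trans dqs lt2.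
    have cq : central q.
      case: Ei => [E|[<-|E]]; [|exact: central_part|]; apply: (@central_near i).
        by rewrite E distC.
      by rewrite E distC.
    have qq : dist q q < 2 by rewrite /dist !subrr expr0n addr0 sqrtr0.
    have [a Ea] := central_allpts cq dqp Ap.
    have [b Eb] := central_allpts cq qq Aq.
    have [c Ec] := central_allpts cq dqs' As.
    apply: (no (a, b, c)); last by rewrite /wpos3 /= Ea Eb Ec.
    rewrite /tri /near /= !wpart_sub Ea Eb Ec dpq dqs !andbT /=.
    apply/and3P; split; apply/eqP => E;
      [apply: ps | apply: pq | apply: qs]; rewrite -?Ea -?Eb -?Ec E //.
  have L u : allpts x u -> (forall i, x i <> u) -> Lminus u.
    by case=> [[j _ <-] /(_ j)|].
  have Lp : Lminus p by apply: L => // i E; apply: np; exists i; left.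
  have Lq : Lminus q by apply: L => // i E; apply: np; exists i; right; left.
  have Ls : Lminus s by apply: L => // i E; apply: np; exists i; right; right.
  have [h1 [h2 [h3 _]]] := v3_right.
  have := @lattice_right R p q s Lp Lq Ls.
  case; try (by apply/eqP); try (by apply: lt_trans r0_lt).
  + by apply/eqP => E; apply: qs; rewrite E.
  + by rewrite distC; apply: lt_trans r0_lt.
  + by move=> ->; rewrite h1.
  + by case=> ->; rewrite ?h2 ?h3.
Qed.

Lemma fenergy_le : ((fenergy beta r0 cap v3 wpos wsub wpart)%:E <= energy v2 v3 beta r0 x)%E.
Proof.
rewrite /energy /fenergy !EFinD !EFinM triple_sum.
apply: leeD => //; apply: leeD.
- apply: lee_wpmul2l => //; rewrite /pair_energy.
  rewrite (eq_bigl (fun t => (t \in wpart) && true)); last by move=> t; rewrite andbT.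
  rewrite (@big_wpart _ (fun _ => true)) /= -sumEFin; apply: lee_sum => i _.
  rewrite (@big_wpart _ (fun t => t != inl i)) /= -sumEFin; apply: lee_sum => j _.
  exact/cap_le/dist_ge0.
- apply: lee_wpmul2l; first by rewrite lee_fin ltW.
  rewrite /sub_energy (eq_bigl (fun t => (t \in wpart) && true)); last by move=> t; rewrite andbT.
  rewrite (@big_wpart _ (fun _ => true)) /= -sumEFin; apply: lee_sum => i _.
  rewrite (@fsbig_window _ _ (mem wsub) wpos).
  + by rewrite -sumEFin; apply: lee_sum => z _; exact/cap_le/dist_ge0.
  + by move=> a b _ _; exact: wpos_inj.
  + by move=> t; exact: wpos_sub.
  + move=> q Lq no; apply: v2_far; rewrite leNgt; apply/negP => dq.
    have lt2 := lt_trans r0_lt sqrt2_lt2.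
    have [t ts E] := central_window (central_part i) (lt_trans dq lt2) Lq.
    by apply: (no t ts).
Qed.

Lemma card_wpart : #|wpart| = N.
Proof.
have -> : wpart = [set inl i | i : 'I_N].
  apply/setP => -[i|ab]; rewrite inE; apply/esym; first exact: imset_f.
  by apply/imsetP => -[].
by rewrite card_imset ?card_ord // => i j [].
Qed.

Lemma card_bottom : #|bottom wpos wpart| = #|[set i : 'I_N | (x i).2 == 1%R]|.
Proof.
have -> : bottom wpos wpart = [set inl i | i in [set i : 'I_N | (x i).2 == 1%R]].
  apply/setP => -[i|ab]; rewrite !inE /=; last by apply/esym/imsetP => -[].
  by rewrite mem_imset ?inE // => j k [].
by rewrite card_imset // => i j [].
Qed.

End Window.

Local Open Scope classical_set_scope.
Local Open Scope ring_scope.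

Lemma window_size (R : realType) (N : nat) (x : 'I_N -> R * R) :
  exists K : nat, forall i, `|(x i).1| + 5 <= K%:R /\ `|(x i).2| + 5 <= K%:R.
Proof.
pose S : R := \sum_(i < N) (`|(x i).1| + `|(x i).2| + 5).
exists (Num.trunc S).+1 => i.
have := truncnS_gt S; have : `|(x i).1| + `|(x i).2| + 5 <= S.
  rewrite /S (bigD1 i) //= lerDl; apply: sumr_ge0 => j _.
  by rewrite !addr_ge0.
have := normr_ge0 (x i).1; have := normr_ge0 (x i).2.
by move=> ? ? ? ?; split; lra.
Qed.
Theorem theorem2p1 (R : realType) (beta : R) :
  0 < beta ->
  exists eps0 : R, 0 < eps0 /\
  forall (eps : R) (r0 : R) (v2 : R -> \bar R) (v3 : R -> R),
    0 < eps -> eps < eps0 ->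
    cond_i2 v2 -> cond_ii2 r0 v2 -> cond_iii2 eps v2 ->
    cond_i3 v3 -> cond_ii3 v3 -> cond_iii3 eps v3 -> cond_iv3 eps beta v3 ->
    exists Nbeta : nat, forall (N : nat) (x : 'I_N -> pt R),
      (Nbeta <= N)%N -> injective x -> (forall i, 0 < (x i).2) ->
      ((- 2 * N%:R + 2^-1 * mbeta beta N)%:E <= energy v2 v3 beta r0 x)%E /\
      (energy v2 v3 beta r0 x = (- 2 * N%:R + 2^-1 * mbeta beta N)%:E ->
        (forall i, exists a b : int, x i = (a%:~R, b%:~R)) /\
        (N%:R / (hstar beta N)%:R : R) <= #|[set i : 'I_N | (x i).2 == 1]%SET|%:R).
Proof.
(* As [pi >= 2], this keeps [eps] below [pi / 10] for the slope in (iii_3) and below [pi / 8] for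
   the sectors. *)
move=> beta_gt0; exists 10^-1; split; first by rewrite invr_gt0.
move=> eps r0 v2 v3 eps_gt0 eps_lt [v2_1 [v2_ge v2_gt]] [r0_gt1 [r0_lt v2_far]] _ _ v3_r v3_s v3_o.
exists 1%N => N x N0 x_inj x_gt0.
have [K K_large] := window_size x.
have le := fenergy_le x_inj x_gt0 K_large r0_lt beta_gt0 v2_ge v2_far v3_r.
have vmin r : 0 <= r -> cap v2 r = -1 -> r = 1.
  move=> rge0 /(cap_min v2_ge rge0) E; apply/eqP/contraT => r1.
  by have := v2_gt r rge0 r1; rewrite E ltxx.
have [||lower equal] := fenergy_lower beta_gt0 eps_gt0 eps_lt r0_gt1 r0_lt (cap_ge v2_ge) vmin
  (cap_far v2_far) v3_r v3_s v3_o (wpos_inj x_inj x_gt0) (@wpos_sub R N x K)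
  (wpos_above x_gt0) (wsub_window K_large r0_lt) (A := wpart N K).
- by case=> [i|ab]; rewrite !inE.
- by rewrite card_wpart.
rewrite card_wpart in lower equal; split; first by apply: le_trans le; rewrite lee_fin.
(* The window energy is at most [energy], so equality puts it at or below the bound, as [equal]
   asks. *)
move=> E; have [|lat bot] := equal; first by rewrite -lee_fin -E.
split=> [i|]; first by apply: (lat (inl i)); rewrite inE.
by rewrite card_wpart (card_bottom x K) in bot.
Qed.
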